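(* Let $(M^n,g)$, $n>3$, be a connected Riemannian manifold (not necessarily compact), let $\xi$ be a Killing vector field on $M$, not identically zero, and suppose that its covariant derivative $u:=\nabla\xi$, viewed as a $2$-form, is a twistor $2$-form. Let $M_0=\{x\in M:\xi_x\neq0\}$ and let $f$ be the function defined on $M_0$ by $$\nabla_Xu=fX\wedge\xi\qquad\text{for all }X\in TM_0 .$$ Then either $f$ is constant on $M$ (that is, on the set $M_0$ where it is defined), or $u$ has rank $2$ on $M$ and $\xi\wedge u=0$.
   Context: Vectors and $1$-forms are identified via the metric, as are skew-symmetric endomorphisms $u$ of $TM$ and $2$-forms: $u(X,Y)=\langle u(X),Y\rangle$. Here $u(X):=\nabla_X\xi$ is skew-symmetric because $\xi$ is Killing, and as a $2$-form $u=\frac12d\xi$. The rank of $u$ is its rank as a skew-symmetric endomorphism. A $p$-form $u$ on a Riemannian manifold $M^n$ is a twistor form if $\nabla_Xu=\frac1{p+1}X\lrcorner du-\frac1{n-p+1}X\wedge\delta u$ for all vector fields $X$, where $\nabla$ is the Levi-Civita connection, $d$ the exterior derivative and $\delta$ the codifferential. In the situation of the claim, $u$ is a closed twistor form, so $\nabla_Xu=\frac1{1-n}X\wedge\delta u$; moreover $\xi\wedge\delta u=0$, so there is a well-defined function $f$ on the dense open set $M_0$ with $\delta u=(1-n)f\xi$, i.e. $\nabla_Xu=fX\wedge\xi$.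
   Formalization: ''u has rank 2 on M'' is proved as: u has rank 2 on a dense subset of M and rank at most 2 everywhere; rank exactly 2 at every point is false, since u can vanish at some points (e.g. g = h²dt²+ds²+h'²g_S, h = 1+s²/2+s⁴, ξ = ∂_t, at s = 0). *)

(* Defs.v *)
(* Riemannian geometry in local coordinates, on top of MathComp-Analysis.

   A manifold is a topological space with an indexed family of charts; a tensor
   field is a family of component functions, one for each chart, defined on the
   image of the chart and related by the usual transformation law.  Functions
   on an open subset of R^n are total functions on 'rV[R]_n: only their values
   on that subset matter. *)
From HB Require Import structures.
From mathcomp Require Import all_boot all_order all_algebra.
From mathcomp Require Import all_classical all_reals all_analysis.
Set Implicit Arguments.
Unset Strict Implicit.
Unset Printing Implicit Defensive.
Import Order.TTheory GRing.Theory Num.Theory.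
Import numFieldNormedType.Exports.
Local Open Scope classical_set_scope.
Local Open Scope ring_scope.

Section Calculus.
Variables (R : realType) (n : nat).

Definition basis_vec (i : 'I_n) : 'rV[R]_n := delta_mx 0 i.

Definition partial (V : normedModType R) (i : 'I_n) (F : 'rV[R]_n -> V)
  : 'rV[R]_n -> V := fun p => 'D_(basis_vec i) F p.

(* [class_C k U F]: F is of class C^k on the open set U. *)
Fixpoint class_C (V : normedModType R) (k : nat) (U : set 'rV[R]_n)
    (F : 'rV[R]_n -> V) : Prop :=
  match k with
  | 0%N => forall p, U p -> {for p, continuous F}
  | k'.+1 => (forall p, U p -> differentiable F p) /\
             forall i, class_C k' U (partial i F)
  end.

Definition smooth_on (V : normedModType R) (U : set 'rV[R]_n)
    (F : 'rV[R]_n -> V) : Prop := forall k, class_C k U F.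

(* A covariant p-tensor at a point, given by its components
   w I = w(e_(I 0), ..., e_(I (p-1))) on the coordinate frame.  Differential
   forms are the alternating ones. *)
Definition pform (p : nat) := ('I_p -> 'I_n) -> R.

Definition icons (p : nat) (l : 'I_n) (I : 'I_p -> 'I_n) : 'I_p.+1 -> 'I_n :=
  fun i => if unlift ord0 i is Some j then I j else l.

Definition form1 (a : 'rV[R]_n) : pform 1 := fun I => a 0 (I ord0).

(* (X _| w)(Y_1, ..., Y_p) = w(X, Y_1, ..., Y_p) *)
Definition interior (p : nat) (X : 'rV[R]_n) (w : pform p.+1) : pform p :=
  fun I => \sum_k X 0 k * w (icons k I).

(* (a /\ w)(Y_0, ..., Y_p) = \sum_i (-1)^i a(Y_i) w(..., omit Y_i, ...) for a
   covector a; in particular (a /\ b)(Y, Z) = a(Y) b(Z) - a(Z) b(Y). *)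
Definition wedge1 (p : nat) (a : 'rV[R]_n) (w : pform p) : pform p.+1 :=
  fun I => \sum_(i < p.+1) (-1) ^+ i * a 0 (I i) * w (I \o lift i).

(* (dw)_I = \sum_i (-1)^i d_(I i) w_(I omitting i), without a 1/(p+1) factor:
   for a 1-form, dw(X, Y) = (nabla_X w)(Y) - (nabla_Y w)(X). *)
Definition ext_d (p : nat) (w : 'rV[R]_n -> pform p) : 'rV[R]_n -> pform p.+1 :=
  fun x I => \sum_(i < p.+1)
    (-1) ^+ i * partial (I i) (fun y => w y (I \o lift i) : R) x.

End Calculus.

Section LocalGeometry.
Variables (R : realType) (n : nat).
(* g p is the Gram matrix (g_ij)(p) of the metric in the coordinate frame. *)
Variable g : 'rV[R]_n -> 'M[R]_n.

(* The 1-form identified with the vector X at the point x. *)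
Definition flat (x X : 'rV[R]_n) : 'rV[R]_n := X *m g x.

(* Christoffel symbol Gamma^k_ij of the Levi-Civita connection. *)
Definition christoffel (k i j : 'I_n) (x : 'rV[R]_n) : R :=
  2^-1 * \sum_l invmx (g x) k l *
    (partial i g x j l + partial j g x i l - partial l g x i j).

(* The endomorphism X |-> nabla_X xi, acting on row vectors by X *m _ :
   row i is nabla_(e_i) xi. *)
Definition cov_vec (xi : 'rV[R]_n -> 'rV[R]_n) (x : 'rV[R]_n) : 'M[R]_n :=
  \matrix_(i, k) (partial i xi x 0 k + \sum_j christoffel k i j x * xi x 0 j).

(* The 2-tensor u(X, Y) = <nabla_X xi, Y>. *)
Definition cov_form (xi : 'rV[R]_n -> 'rV[R]_n) (x : 'rV[R]_n) : pform R n 2 :=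
  fun I => (cov_vec xi x *m g x) (I ord0) (I ord_max).

(* The Lie derivative of g along xi:
   (L_xi g)_ij = xi^k d_k g_ij + (d_i xi^k) g_kj + (d_j xi^k) g_ik. *)
Definition lie_metric (xi : 'rV[R]_n -> 'rV[R]_n) (x : 'rV[R]_n) : 'M[R]_n :=
  \matrix_(i, j) \sum_k (xi x 0 k * partial k g x i j
    + partial i xi x 0 k * g x k j + partial j xi x 0 k * g x i k).

(* nabla_(e_k) w = d_k w_I - \sum_i \sum_l Gamma^l_(k, I i) w_(I with I i := l) *)
Definition cov_coord (p : nat) (w : 'rV[R]_n -> pform R n p) (x : 'rV[R]_n)
    (k : 'I_n) : pform R n p :=
  fun I => partial k (fun y => w y I : R) x
    - \sum_i \sum_l christoffel l k (I i) x * w x (dfwith I i l).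

Definition cov_deriv (p : nat) (w : 'rV[R]_n -> pform R n p) (x X : 'rV[R]_n)
    : pform R n p :=
  fun I => \sum_k X 0 k * cov_coord w x k I.

(* delta w = - \sum_i E_i _| nabla_(E_i) w for an orthonormal frame E_i *)
Definition codiff (p : nat) (w : 'rV[R]_n -> pform R n p.+1) (x : 'rV[R]_n)
    : pform R n p :=
  fun I => - \sum_k \sum_l invmx (g x) k l * cov_coord w x k (icons l I).

(* The twistor equation for a form of degree p.+1 at the point x. *)
Definition twistor_at (p : nat) (w : 'rV[R]_n -> pform R n p.+1)
    (x : 'rV[R]_n) : Prop :=
  forall (X : 'rV[R]_n) (I : 'I_p.+1 -> 'I_n),
    cov_deriv w x X I =
      (p.+1%:R + 1)^-1 * interior X (ext_d w x) I
      - (n%:R - p.+1%:R + 1)^-1 * wedge1 (flat x X) (codiff w x) I.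

End LocalGeometry.

Section Manifolds.
Variables (R : realType) (n : nat).

Record chart (M : topologicalType) := Chart {
  chart_dom : set M;
  chart_img : set 'rV[R]_n;
  chart_map : M -> 'rV[R]_n;
  chart_inv : 'rV[R]_n -> M;
  chart_dom_open : open chart_dom;
  chart_img_open : open chart_img;
  chart_mapP : forall x, chart_dom x -> chart_img (chart_map x);
  chart_invP : forall p, chart_img p -> chart_dom (chart_inv p);
  chart_mapK : forall x, chart_dom x -> chart_inv (chart_map x) = x;
  chart_invK : forall p, chart_img p -> chart_map (chart_inv p) = p;
  chart_map_cont : forall x, chart_dom x -> {for x, continuous chart_map};
  chart_inv_cont : forall p, chart_img p -> {for p, continuous chart_inv} }.

(* The change of coordinates from the chart a to the chart b, and the open
   subset of R^n on which it is defined. *)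
Definition transition (M : topologicalType) (a b : chart M)
  : 'rV[R]_n -> 'rV[R]_n := chart_map b \o chart_inv a.
Definition overlap (M : topologicalType) (a b : chart M) : set 'rV[R]_n :=
  chart_img a `&` chart_inv a @^-1` chart_dom b.

Record smooth_manifold := SmoothManifold {
  carrier :> topologicalType;
  manifold_hausdorff : hausdorff_space carrier;
  manifold_countable : @second_countable carrier;
  chart_index : Type;
  chart_of : chart_index -> chart carrier;
  chart_cover : forall x, exists a, chart_dom (chart_of a) x;
  chart_compat : forall a b, smooth_on (overlap (chart_of a) (chart_of b))
                               (transition (chart_of a) (chart_of b)) }.

Variable M : smooth_manifold.
Implicit Types a b : chart_index M.

Local Notation img a := (chart_img (chart_of a)).
Local Notation overlap_of a b := (overlap (chart_of a) (chart_of b)).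
Local Notation change a b := (transition (chart_of a) (chart_of b)).

Record riemannian_metric := RiemannianMetric {
  gram :> chart_index M -> 'rV[R]_n -> 'M[R]_n;
  gram_smooth : forall a, smooth_on (img a) (gram a);
  gram_sym : forall a p, img a p -> (gram a p)^T = gram a p;
  gram_pos : forall a p, img a p ->
    forall X : 'rV[R]_n, X != 0 -> 0 < (X *m gram a p *m X^T) 0 0;
  gram_change : forall a b p, overlap_of a b p -> forall X Y : 'rV[R]_n,
    (X *m gram a p *m Y^T) 0 0 =
    ('d (change a b) p X *m gram b (change a b p)
       *m ('d (change a b) p Y : 'rV[R]_n)^T) 0 0 }.

Record vector_field := VectorField {
  vf_comp :> chart_index M -> 'rV[R]_n -> 'rV[R]_n;
  vf_smooth : forall a, smooth_on (img a) (vf_comp a);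
  vf_change : forall a b p, overlap_of a b p ->
    vf_comp b (change a b p) = 'd (change a b) p (vf_comp a p) }.

(* The set of points x such that P holds in every chart around x, at the
   coordinates of x.  Below, P is always independent of the chart. *)
Definition in_charts (P : chart_index M -> 'rV[R]_n -> Prop) : set M :=
  [set x | forall a, chart_dom (chart_of a) x ->
                     P a (chart_map (chart_of a) x)].

Definition killing (g : riemannian_metric) (xi : vector_field) : Prop :=
  forall x, in_charts (fun a p => lie_metric (g a) (xi a) p = 0) x.

Definition twistor_form (g : riemannian_metric) (k : nat)
    (w : chart_index M -> 'rV[R]_n -> pform R n k.+1) : Prop :=
  forall x, in_charts (fun a p => twistor_at (g a) (w a) p) x.

(* The covariant derivative u = nabla xi, as a 2-form. *)
Definition nabla_form (g : riemannian_metric) (xi : vector_field)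
  : chart_index M -> 'rV[R]_n -> pform R n 2 :=
  fun a => cov_form (g a) (xi a).

(* The set M_0 of points at which xi does not vanish. *)
Definition nonzero_locus (xi : vector_field) : set M :=
  in_charts (fun a p => xi a p != 0).

(* nabla_X w = c X /\ xi at the point x, for all X. *)
Definition nabla_eq_wedge (g : riemannian_metric) (xi : vector_field)
    (w : chart_index M -> 'rV[R]_n -> pform R n 2) (c : R) (x : M) : Prop :=
  in_charts (fun a p => forall (X : 'rV[R]_n) (I : 'I_2 -> 'I_n),
    cov_deriv (g a) (w a) p X I =
    c * wedge1 (flat (g a) p X) (form1 (flat (g a) p (xi a p))) I) x.

(* The points at which the endomorphism X |-> nabla_X xi has rank r, resp.
   rank at most r. *)
Definition nabla_rank (g : riemannian_metric) (xi : vector_field) (r : nat)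
  : set M := in_charts (fun a p => \rank (cov_vec (g a) (xi a) p) = r).
Definition nabla_rank_le (g : riemannian_metric) (xi : vector_field) (r : nat)
  : set M := in_charts (fun a p => (\rank (cov_vec (g a) (xi a) p) <= r)%N).

(* nabla xi has rank r as a 2-form on M: its rank is r at the points of a dense
   (automatically open) set, and at most r at the remaining ones.  The rank may
   drop at special points: for h(s) = 1 + s^2/2 + s^4 and the metric
     h(s)^2 dt^2 + ds^2 + h'(s)^2 g_(S^(n-2))   on R x R^(n-1)
   (s being the distance to 0 in R^(n-1)), xi = d/dt is a Killing field whose
   covariant derivative u is a twistor form, with f = h''/h not constant;
   there u = h h' ds /\ dt has rank 2 where s <> 0 and vanishes where s = 0. *)
Definition nabla_has_rank (g : riemannian_metric) (xi : vector_field) (r : nat)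
  : Prop :=
  dense (nabla_rank g xi r) /\ forall x, nabla_rank_le g xi r x.

(* The 3-form xi /\ w vanishes identically. *)
Definition wedge_vanishes (g : riemannian_metric) (xi : vector_field)
    (w : chart_index M -> 'rV[R]_n -> pform R n 2) : Prop :=
  forall x, in_charts (fun a p => forall I : 'I_3 -> 'I_n,
    wedge1 (flat (g a) p (xi a p)) (w a p) I = 0) x.

End Manifolds.

(* Main.v *)
(* Where xi does not vanish, write nabla_X u = f X /\ xi. The Ricci identity for u
   says that the curvature tensor, minus f times the one of the unit sphere, commutes
   with u up to terms in df. Wherever df <> 0 this forces, by the symmetries of the
   curvature, u = xi /\ alpha with alpha <> 0, so that xi /\ u = 0 and u /\ u = 0.

   The passage to all of M is by unique continuation: each of the following satisfies
   a first order linear system with locally bounded coefficients, so that by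
   Gronwall's lemma it vanishes identically on a ball of a chart as soon as it
   vanishes at one of its points.
   - (xi, u), by Kostant's identity: hence M_0 is dense;
   - (xi /\ u, u /\ u): hence xi /\ u = 0 everywhere and u has rank at most 2;
   - (u, delta u): hence u is not zero on a dense set if f is not constant;
   - (f - c) xi and (f - c) u, if df = 0 on M_0: hence f is constant on M_0, even
     though M_0 is not known to be connected.
   The function f is locally bounded near the zeros of xi, being a sectional
   curvature. *)
Require Import Defs.
From HB Require Import structures.
From mathcomp Require Import all_boot all_order all_algebra.
From mathcomp Require Import all_classical all_reals all_analysis.
From mathcomp Require Import ring lra.
Set Implicit Arguments.
Unset Strict Implicit.
Unset Printing Implicit Defensive.
Import Order.TTheory GRing.Theory Num.Theory.
Import numFieldNormedType.Exports.
Local Open Scope classical_set_scope.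
Local Open Scope ring_scope.

(** The zero set of xi shapes the argument. There [f] has no meaning, and around it neither a bound
    nor any regularity of [f] is given, so every quantity that is propagated has to be smooth on
    whole charts. The product f xi is reached through the form sigma = - (delta u) / (n - 1), which
    is smooth everywhere and equal to f xi on M_0. It yields the smoothness of [f] on M_0; and since
    Kostant's identity makes nabla u a contraction of the curvature with xi, it also yields a bound
    |f| |xi| <= C |xi|, whence the local bound on [f]. The differential inequalities are checked on
    M_0 only and extended by density. The unknowns come in pairs because neither member satisfies a
    closed system alone: differentiating one brings in the other. *)

Lemma near_eq_differentiable (R : realType) (V W : normedModType R)
    (f g : V -> W) (x : V) :
  {near x, f =1 g} -> differentiable f x -> differentiable g x.
Proof.
move=> fg df.
have fgx : f x = g x by exact: nbhs_singleton fg.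
have dg : g \o shift x = cst (g x) + 'd f x +o_ 0 id.
  have := diff_locally df => /eqaddoP H; apply/eqaddoP => e e0.
  have H2 : \forall h \near (0 : V), f (h + x) = g (h + x).
    by have := fg; rewrite (near_shift 0) subr0.
  apply: filterS2 (H e e0) H2 => h /=; rewrite -fgx !fctE /= => + gE.
  by rewrite gE.
have cd : continuous ('d f x) by exact: diff_continuous.
by apply/diff_locallyP; rewrite (diff_unique cd dg).
Qed.

(** * Functions of class C^k on open subsets of R^n *)

Section ClassC.
Variables (R : realType) (n : nat).

Lemma near_open (T : topologicalType) (O : set T) (P : T -> Prop) p :
  open O -> O p -> (forall q, O q -> P q) -> \forall q \near p, P q.
Proof. by move=> oO Op OP; apply: filterS (open_nbhs_nbhs (conj oO Op)). Qed.

(** Regularity on an open set depends only on the values there. This lets the rules below be proved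
    for convenient expressions and transferred to functions that may differ from them outside the
    chart. *)
Lemma class_C_eq_on (V : normedModType R) k (U W : set 'rV[R]_n)
    (F G : 'rV[R]_n -> V) :
  open W -> W `<=` U -> (forall p, W p -> F p = G p) ->
  class_C k U F -> class_C k W G.
Proof.
move=> oW WU; elim: k F G => [|k IH] F G FG /=.
  move=> cF p Wp; have nFG : \forall q \near p, F q = G q by exact: near_open FG.
  rewrite /prop_for /continuous_at -(FG p Wp).
  have := cF p (WU _ Wp); apply: cvg_trans.
  apply: (@near_eq_cvg _ _ (nbhs p)).
  by apply: filterS nFG => q /esym.
case=> dF cF; split=> [p Wp|i].
  by apply: near_eq_differentiable (dF _ (WU _ Wp)); exact: near_open FG.
apply: (IH (partial i F)) => // p Wp; apply: near_eq_derive.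
exact: near_open FG.
Qed.

Lemma class_C_cont (V : normedModType R) k (U : set 'rV[R]_n) (F : 'rV[R]_n -> V) :
  class_C k U F -> class_C 0 U F.
Proof.
case: k => //= k [dF _] p Up; exact/differentiable_continuous/dF.
Qed.

Lemma class_C_pred (V : normedModType R) k (U : set 'rV[R]_n) (F : 'rV[R]_n -> V) :
  class_C k.+1 U F -> class_C k U F.
Proof.
elim: k F => [|k IH] F; first exact: class_C_cont.
by case=> dF cF; split=> // i; apply: IH; exact: cF.
Qed.

Implicit Types (O : set 'rV[R]_n) (F G : 'rV[R]_n -> R).

Lemma class_C_cst k O (c : R) : class_C k O (fun=> c).
Proof.
elim: k c => [|k IH] c /=; first by move=> p _; exact: cst_continuous.
split=> [p _|i]; first exact: differentiable_cst.
have -> : partial i (fun=> c) = (fun=> 0).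
  by apply/funext => p; exact: derive_cst.
exact: IH.
Qed.

Lemma class_CD k O F G : open O ->
  class_C k O F -> class_C k O G -> class_C k O (fun q => F q + G q).
Proof.
move=> oO; elim: k F G => [|k IH] F G /=.
  by move=> cF cG p Op; apply: continuousD; [exact: cF|exact: cG].
move=> [dF cF] [dG cG]; split=> [p Op|i].
  by apply: differentiableD; [exact: dF|exact: dG].
apply: (class_C_eq_on _ _ _ (IH _ _ (cF i) (cG i))) => // p Op.
by rewrite /partial deriveD //; apply: diff_derivable; [exact: dF|exact: dG].
Qed.

Lemma class_CM k O F G : open O ->
  class_C k O F -> class_C k O G -> class_C k O (fun q => F q * G q).
Proof.
move=> oO; elim: k F G => [|k IH] F G.
  by move=> /= cF cG p Op; apply: continuousM; [exact: cF|exact: cG].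
move=> CF CG; case: (CF) (CG) => [dF cF] [dG cG]; split=> [p Op|i].
  by apply: differentiableM; [exact: dF|exact: dG].
apply: (class_C_eq_on (F := fun q => F q * partial i G q + G q * partial i F q)
  (U := O)) => // [p Op|].
  by rewrite /partial deriveM //; apply: diff_derivable; [exact: dF|exact: dG].
apply: class_CD => //; first exact: (IH _ _ (class_C_pred CF) (cG i)).
exact: (IH _ _ (class_C_pred CG) (cF i)).
Qed.

Lemma class_CV k O F : open O -> (forall q, O q -> F q != 0) ->
  class_C k O F -> class_C k O (fun q => (F q)^-1).
Proof.
move=> oO F0; elim: k => [|k IH].
  by move=> /= cF p Op; apply: continuousV; [exact: F0|exact: cF].
move=> CF; case: (CF) => [dF cF]; split=> [p Op|i].
  by apply: differentiableV; [exact: dF|exact: F0].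
apply: (class_C_eq_on
  (F := fun q => -1 * ((F q)^-1 * (F q)^-1 * partial i F q)) (U := O))
  => // [p Op|].
  rewrite /partial deriveV ?F0 //; last exact/diff_derivable/dF.
  by rewrite mulN1r scaleNr -exprVn expr2.
have CV := IH (class_C_pred CF).
apply: class_CM => //; first exact: class_C_cst.
apply: class_CM => //; last exact: cF.
exact: class_CM.
Qed.

Lemma smooth_on_eq (V : normedModType R) (U W : set 'rV[R]_n)
    (F G : 'rV[R]_n -> V) :
  open W -> W `<=` U -> (forall p, W p -> F p = G p) ->
  smooth_on U F -> smooth_on W G.
Proof. by move=> oW WU FG sF k; exact: class_C_eq_on (sF k). Qed.

Lemma smooth_on_subset (V : normedModType R) (U W : set 'rV[R]_n)
    (F : 'rV[R]_n -> V) :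
  open W -> W `<=` U -> smooth_on U F -> smooth_on W F.
Proof. by move=> oW WU; exact: smooth_on_eq. Qed.

Lemma smooth_on_diff (V : normedModType R) (U : set 'rV[R]_n) (F : 'rV[R]_n -> V) p :
  smooth_on U F -> U p -> differentiable F p.
Proof. by move=> sF Up; have [+ _] := sF 1%N; apply. Qed.

Lemma smooth_on_cont (V : normedModType R) (U : set 'rV[R]_n) (F : 'rV[R]_n -> V) p :
  smooth_on U F -> U p -> {for p, continuous F}.
Proof. by move=> sF Up; have := sF 0%N; apply. Qed.

Lemma smooth_on_partial (V : normedModType R) (U : set 'rV[R]_n) (F : 'rV[R]_n -> V) i :
  smooth_on U F -> smooth_on U (partial i F).
Proof. by move=> sF k; have [_] := sF k.+1; apply. Qed.

Lemma smooth_on_cst O (c : R) : smooth_on O (fun=> c).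
Proof. by move=> k; exact: class_C_cst. Qed.

Lemma smooth_onD O F G : open O ->
  smooth_on O F -> smooth_on O G -> smooth_on O (fun q => F q + G q).
Proof. by move=> oO sF sG k; exact: class_CD. Qed.

Lemma smooth_onM O F G : open O ->
  smooth_on O F -> smooth_on O G -> smooth_on O (fun q => F q * G q).
Proof. by move=> oO sF sG k; exact: class_CM. Qed.

Lemma smooth_onV O F : open O -> (forall q, O q -> F q != 0) ->
  smooth_on O F -> smooth_on O (fun q => (F q)^-1).
Proof. by move=> oO F0 sF k; exact: class_CV. Qed.

Lemma smooth_onN O F : open O ->
  smooth_on O F -> smooth_on O (fun q => - F q).
Proof.
move=> oO sF; apply: (smooth_on_eq (U := O) (F := fun q => -1 * F q)) => //.
  by move=> p _; rewrite mulN1r.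
by apply: smooth_onM => //; exact: smooth_on_cst.
Qed.

Lemma smooth_onB O F G : open O ->
  smooth_on O F -> smooth_on O G -> smooth_on O (fun q => F q - G q).
Proof. by move=> oO sF sG; apply: smooth_onD => //; exact: smooth_onN. Qed.

Lemma smooth_on_sum O (I : Type) (r : seq I) (P : pred I) (F : I -> 'rV[R]_n -> R) :
  open O -> (forall i, smooth_on O (F i)) ->
  smooth_on O (fun q => \sum_(i <- r | P i) F i q).
Proof.
move=> oO sF; elim: r => [|i r IH].
  by apply: (smooth_on_eq (U := O) (F := fun=> (0 : R))) => // [p _|];
    [rewrite big_nil|exact: smooth_on_cst].
apply: (smooth_on_eq (U := O)
  (F := fun q => (if P i then F i q else 0) + \sum_(j <- r | P j) F j q)) => //.
  by move=> p _; rewrite big_cons; case: (P i) => //; rewrite add0r.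
apply: smooth_onD => //; case: (P i) => //; exact: smooth_on_cst.
Qed.

Lemma smooth_on_prod O (I : Type) (r : seq I) (P : pred I) (F : I -> 'rV[R]_n -> R) :
  open O -> (forall i, smooth_on O (F i)) ->
  smooth_on O (fun q => \prod_(i <- r | P i) F i q).
Proof.
move=> oO sF; elim: r => [|i r IH].
  by apply: (smooth_on_eq (U := O) (F := fun=> (1 : R))) => // [p _|];
    [rewrite big_nil|exact: smooth_on_cst].
apply: (smooth_on_eq (U := O)
  (F := fun q => (if P i then F i q else 1) * \prod_(j <- r | P j) F j q)) => //.
  by move=> p _; rewrite big_cons; case: (P i) => //; rewrite mul1r.
apply: smooth_onM => //; case: (P i) => //; exact: smooth_on_cst.
Qed.

Lemma smooth_on_coord a b O (A : 'rV[R]_n -> 'M[R]_(a, b)) i j : open O ->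
  smooth_on O A -> smooth_on O (fun q => A q i j).
Proof.
move=> oO sA k; elim: k A sA => [|k IH] A sA /=.
  move=> p Op.
  apply: (@continuous_comp _ _ _ A (fun M : 'M[R]_(a, b) => M i j)).
    exact: (smooth_on_cont sA Op).
  exact: coord_continuous.
split=> [p Op|l].
  apply: (@differentiable_comp _ _ _ _ A (fun M : 'M[R]_(a, b) => M i j)).
    exact: (smooth_on_diff sA Op).
  exact: differentiable_coord.
apply: (class_C_eq_on (U := O) (F := fun q => partial l A q i j)) => // [p Op|].
  rewrite /partial derive_mx ?mxE //; exact/diff_derivable/(smooth_on_diff sA Op).
by apply: IH; exact: smooth_on_partial.
Qed.

End ClassC.

(** * Symmetry of second derivatives *)

Section Directional.
Variables (R : realType) (n : nat).
Implicit Types (O : set 'rV[R]_n) (F G : 'rV[R]_n -> R) (X Y p : 'rV[R]_n).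

Lemma derive_dir (V : normedModType R) (F : 'rV[R]_n -> V) X p :
  differentiable F p -> 'D_X F p = \sum_i X 0 i *: partial i F p.
Proof.
move=> dF; rewrite deriveE // {1}(row_sum_delta X) linear_sum.
by apply: eq_bigr => i _; rewrite linearZ /partial deriveE.
Qed.

Lemma smooth_on_dir O F X : open O -> smooth_on O F -> smooth_on O ('D_X F).
Proof.
move=> oO sF.
apply: (smooth_on_eq (U := O) (F := fun q => \sum_i X 0 i * partial i F q)) => //.
  by move=> p Op; rewrite (derive_dir _ (smooth_on_diff sF Op)).
apply: smooth_on_sum => // i; apply: smooth_onM => //.
  exact: smooth_on_cst.
exact: smooth_on_partial.
Qed.

Lemma is_derive_line (F : 'rV[R]_n -> R) p X (s : R) :
  differentiable F (p + s *: X) ->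
  is_derive s 1 (fun t : R => F (p + t *: X)) ('D_X F (p + s *: X)).
Proof.
move=> dF.
have dl : is_diff s (fun t : R => p + t *: X) (fun t => t *: X).
  have -> : (fun t : R => t *: X) = 0 + (fun t : R => t *: X).
    by apply/funext => t; rewrite fctE /= add0r.
  exact: is_diffD.
have dl' : differentiable (fun t : R => p + t *: X) s by [].
have dc : differentiable (fun t : R => F (p + t *: X)) s.
  exact: (@differentiable_comp _ _ _ _ (fun t : R => p + t *: X) F).
apply: DeriveDef; first exact: diff_derivable.
rewrite deriveE // (@diff_comp _ _ _ _ (fun t : R => p + t *: X) F) //=.
by rewrite (@diff_val _ _ _ _ _ _ _ dl) scale1r deriveE.
Qed.

Lemma MVT_line F p X (h : R) : 0 < h ->
  (forall t, 0 <= t <= h -> differentiable F (p + t *: X)) ->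
  exists2 c, 0 <= c <= h & F (p + h *: X) - F p = h * 'D_X F (p + c *: X).
Proof.
move=> h0 dF.
have [||c] := @MVT R (fun t : R => F (p + t *: X)) (fun t => 'D_X F (p + t *: X)) 0 h h0.
- move=> t; rewrite in_itv /= => /andP[t0 th].
  by apply: is_derive_line; apply: dF; rewrite !ltW.
- apply: derivable_within_continuous => t; rewrite in_itv /= => ht.
  by have [] := is_derive_line (dF t ht).
- rewrite in_itv /= => /andP[c0 ch]; rewrite scale0r addr0 subr0 => E.
  by exists c; rewrite ?ltW // E mulrC.
Qed.

(** The mixed second difference [z - w - v + u] is symmetric in [v] and [w]; if both [k * a] and
    [k * b] approximate it, then [a] and [b] are close. *)
Lemma double_difference (e k a b u v w z : R) : 0 < k ->
    `|z - w - (v - u) - k * a| <= k * (e / 2) ->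
    `|z - v - (w - u) - k * b| <= k * (e / 2) -> `|a - b| <= e.
Proof.
move=> k0 K1 K2; rewrite -(ler_pM2l k0) -{1}(ger0_norm (ltW k0)) -normrM.
by move: K1 K2; rewrite !ler_norml; lra.
Qed.

(** The mean value theorem is used twice: along [Y] for the increment of [F] in the direction [X],
    then along [X] for ['D_Y F]. The intermediate point lies in a ball where the second derivative
    differs from its value at [p] by less than [e]. *)
Lemma second_difference O F p X Y (e : R) : open O -> O p -> smooth_on O F -> 0 < e ->
  \forall h \near 0^'+, `|F (p + h *: X + h *: Y) - F (p + h *: X)
     - (F (p + h *: Y) - F p) - h ^+ 2 * 'D_X ('D_Y F) p| <= h ^+ 2 * e.
Proof.
move=> oO Op sF e0.
have sDD : smooth_on O ('D_X ('D_Y F)) by do 2 apply: smooth_on_dir => //.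
have cDD : {for p, continuous ('D_X ('D_Y F))} by exact: smooth_on_cont sDD Op.
have : \forall q \near p, O q /\ `|'D_X ('D_Y F) q - 'D_X ('D_Y F) p| < e.
  apply: filterI; first exact: (open_nbhs_nbhs (conj oO Op)).
  by apply: cvgr_distC_lt cDD _ e0.
move=> /nbhs_ballP[d /= d0 Hd].
(* The summand 1 keeps the factor positive when [X] and [Y] vanish, so that [h] can be chosen below
   [d] divided by it. *)
have Hb (s t h : R) : 0 <= s <= h -> 0 <= t <= h -> h * (`|X| + `|Y| + 1) < d ->
    ball p d (p + s *: X + t *: Y).
  move=> /andP[s0 sh] /andP[t0 th] hd; rewrite -ball_normE /=.
  have -> : p - (p + s *: X + t *: Y) = - (s *: X + t *: Y) by rewrite -addrA opprD addNKr.
  rewrite normrN; apply: le_lt_trans hd; apply: (le_trans (ler_normD _ _)).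
  rewrite !normrZ !ger0_norm // !mulrDr -[leLHS]addr0.
  by rewrite !lerD ?ler_wpM2r ?mulr1 // (le_trans s0).
near=> h.
have h0 : 0 < h by near: h; exact: nbhs_right_gt.
have hd : h * (`|X| + `|Y| + 1) < d.
  rewrite -ltr_pdivlMr ?ltr_wpDl ?addr_ge0 //.
  by near: h; apply: nbhs_right_lt; rewrite divr_gt0 ?ltr_wpDl ?addr_ge0.
have hh : 0 <= h <= h by rewrite lexx ltW.
have h00 : 0 <= (0 : R) <= h by rewrite lexx ltW.
pose G q := F (q + h *: X) - F q.
have dF q : O q -> differentiable F q by exact: smooth_on_diff.
have dsh q (v : 'rV[R]_n) : O (q + v) -> differentiable (fun z => F (z + v)) q.
  move=> Oq; apply: (@differentiable_comp _ _ _ _ (fun z => z + v) F); last exact: dF.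
  by have [] : is_diff q (id + cst v) (id + 0) by exact: is_diffD.
have derive_translate q (v : 'rV[R]_n) : 'D_Y (fun z => F (z + v)) q = 'D_Y F (q + v).
  rewrite /derive; do 2 congr (_ _); apply/funext => B.
  rewrite /= /preimage; congr (nbhs _ _); apply/funext => h1 /=.
  by rewrite addrA.
have dG t : 0 <= t <= h -> differentiable G (p + t *: Y) /\
    'D_Y G (p + t *: Y) = 'D_Y F (p + t *: Y + h *: X) - 'D_Y F (p + t *: Y).
  move=> ht.
  have O1 : O (p + t *: Y + h *: X).
    by rewrite addrAC; have [] := Hd _ (Hb h t h hh ht hd).
  have O2 : O (p + t *: Y).
    by have := Hb 0 t h h00 ht hd; rewrite scale0r addr0 => /Hd[].
  split; first exact: (differentiableB (dsh _ _ O1) (dF _ O2)).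
  rewrite -derive_translate; apply: deriveB; apply: diff_derivable.
    exact: dsh.
  exact: dF.
have [c hc E1] := MVT_line h0 (fun t ht => (dG t ht).1).
rewrite (dG c hc).2 in E1.
have [|s hs E2] := @MVT_line ('D_Y F) (p + c *: Y) X h h0.
  move=> t ht; apply: (smooth_on_diff (smooth_on_dir Y oO sF)).
  by rewrite addrAC; have [] := Hd _ (Hb t c h ht hc hd).
rewrite E2 /G in E1.
have -> : F (p + h *: X + h *: Y) - F (p + h *: X) - (F (p + h *: Y) - F p) =
   h * (h * 'D_X ('D_Y F) (p + c *: Y + s *: X)).
  by rewrite -E1 [p + h *: Y + h *: X]addrAC; ring.
rewrite mulrA -expr2 -mulrBr normrM (ger0_norm (exprn_ge0 2 (ltW h0))).
rewrite ler_pM2l ?exprn_gt0 //.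
by rewrite [p + c *: Y + _]addrAC ltW //; have [] := Hd _ (Hb s c h hs hc hd).
Unshelve. all: by end_near. Qed.

Lemma schwarz O F X Y p : open O -> O p -> smooth_on O F ->
  'D_X ('D_Y F) p = 'D_Y ('D_X F) p.
Proof.
move=> oO Op sF; apply/eqP; rewrite -subr_eq0 -normr_le0; apply/ler_addgt0Pl => e e0.
rewrite addr0.
have e2 : 0 < e / 2 by rewrite divr_gt0.
have S1 := second_difference X Y oO Op sF e2.
have S2 := second_difference Y X oO Op sF e2.
have [h [[H1 H2] h0]] := filter_ex (filterI (filterI S1 S2) (nbhs_right_gt (0 : R))).
have h2 : 0 < h ^+ 2 by rewrite exprn_gt0.
have E : p + h *: Y + h *: X = p + h *: X + h *: Y by rewrite addrAC.
rewrite E in H2.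
exact: double_difference h2 H1 H2.
Qed.

End Directional.

(** * Entrywise calculus of matrix-valued functions *)

(** Taken entry by entry, so that all rules reduce to those for real functions; locked, so that
    rewriting does not unfold it. *)
HB.lock Definition dmx (R : realType) (n a b : nat) (X : 'rV[R]_n)
    (A : 'rV[R]_n -> 'M[R]_(a, b)) (q : 'rV[R]_n) : 'M[R]_(a, b) :=
  \matrix_(i, j) 'D_X (fun q => A q i j) q.

Section MatrixCalculus.
Variables (R : realType) (n : nat).
Implicit Types (O : set 'rV[R]_n) (X Y p q : 'rV[R]_n).

Definition smooth_mx a b O (A : 'rV[R]_n -> 'M[R]_(a, b)) :=
  forall i j, smooth_on O (fun q => A q i j).

Lemma dmxE a b X (A : 'rV[R]_n -> 'M[R]_(a, b)) q i j :
  dmx X A q i j = 'D_X (fun q => A q i j) q.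
Proof. by rewrite dmx.unlock mxE. Qed.

Lemma smooth_on_smooth_mx a b O (A : 'rV[R]_n -> 'M[R]_(a, b)) :
  open O -> smooth_on O A -> smooth_mx O A.
Proof. by move=> oO sA i j; exact: smooth_on_coord. Qed.

Section Rules.
Variables (O : set 'rV[R]_n) (oO : open O).

Lemma smooth_mx_eq a b (A B : 'rV[R]_n -> 'M[R]_(a, b)) :
  (forall q, O q -> A q = B q) -> smooth_mx O A -> smooth_mx O B.
Proof.
move=> AB sA i j; apply: (smooth_on_eq (U := O) (F := fun q => A q i j)) => //.
by move=> q Oq; rewrite AB.
Qed.

Lemma dmx_eq a b X (A B : 'rV[R]_n -> 'M[R]_(a, b)) p :
  (forall q, O q -> A q = B q) -> O p -> dmx X A p = dmx X B p.
Proof.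
move=> AB Op; apply/matrixP => i j; rewrite !dmxE; apply: near_eq_derive.
by apply: near_open Op _ => // q Oq; rewrite AB.
Qed.

Lemma smooth_mx_derivable a b (A : 'rV[R]_n -> 'M[R]_(a, b)) i j X p :
  smooth_mx O A -> O p -> derivable (fun q => A q i j) p X.
Proof. by move=> sA Op; exact/diff_derivable/(smooth_on_diff (sA i j) Op). Qed.

Lemma smooth_mx_cst a b (A : 'M[R]_(a, b)) : smooth_mx O (fun=> A).
Proof. by move=> i j; exact: smooth_on_cst. Qed.

Lemma dmx_cst a b X (A : 'M[R]_(a, b)) p : dmx X (fun=> A) p = 0.
Proof. by apply/matrixP => i j; rewrite dmxE derive_cst mxE. Qed.

Lemma smooth_mxD a b (A B : 'rV[R]_n -> 'M[R]_(a, b)) :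
  smooth_mx O A -> smooth_mx O B -> smooth_mx O (fun q => A q + B q).
Proof.
move=> sA sB i j.
apply: (smooth_on_eq (U := O) (F := fun q => A q i j + B q i j)) => //.
  by move=> q _; rewrite mxE.
exact: smooth_onD.
Qed.

Lemma dmxD a b X (A B : 'rV[R]_n -> 'M[R]_(a, b)) p :
  smooth_mx O A -> smooth_mx O B -> O p ->
  dmx X (fun q => A q + B q) p = dmx X A p + dmx X B p.
Proof.
move=> sA sB Op; apply/matrixP => i j; rewrite mxE !dmxE.
have -> : (fun q => (A q + B q) i j) = (fun q => A q i j) + (fun q => B q i j).
  by apply/funext => q; rewrite mxE.
by rewrite deriveD //; exact: smooth_mx_derivable.
Qed.

Lemma smooth_mxM a b c (A : 'rV[R]_n -> 'M[R]_(a, b)) (B : 'rV[R]_n -> 'M[R]_(b, c)) :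
  smooth_mx O A -> smooth_mx O B -> smooth_mx O (fun q => A q *m B q).
Proof.
move=> sA sB i j.
apply: (smooth_on_eq (U := O) (F := fun q => \sum_k A q i k * B q k j)) => //.
  by move=> q _; rewrite mxE.
by apply: smooth_on_sum => // k; exact: smooth_onM.
Qed.

Lemma dmxM a b c X (A : 'rV[R]_n -> 'M[R]_(a, b)) (B : 'rV[R]_n -> 'M[R]_(b, c)) p :
  smooth_mx O A -> smooth_mx O B -> O p ->
  dmx X (fun q => A q *m B q) p = dmx X A p *m B p + A p *m dmx X B p.
Proof.
move=> sA sB Op; apply/matrixP => i j; rewrite mxE dmxE !mxE -big_split /=.
have -> : (fun q => (A q *m B q) i j) = \sum_k (fun q => A q i k * B q k j).
  by apply/funext => q; rewrite mxE fct_sumE.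
rewrite derive_sum => [|k]; last first.
  by apply: derivableM; exact: smooth_mx_derivable.
apply: eq_bigr => k _; rewrite deriveM; first last.
- exact: smooth_mx_derivable.
- exact: smooth_mx_derivable.
- by rewrite addrC dmxE dmxE; congr (_ + _); rewrite mulrC.
Qed.

Lemma smooth_mxZ a b (f : 'rV[R]_n -> R) (A : 'rV[R]_n -> 'M[R]_(a, b)) :
  smooth_on O f -> smooth_mx O A -> smooth_mx O (fun q => f q *: A q).
Proof.
move=> sf sA i j.
apply: (smooth_on_eq (U := O) (F := fun q => f q * A q i j)) => //.
  by move=> q _; rewrite mxE.
exact: smooth_onM.
Qed.

Lemma dmxZ a b X (f : 'rV[R]_n -> R) (A : 'rV[R]_n -> 'M[R]_(a, b)) p :
  smooth_on O f -> smooth_mx O A -> O p ->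
  dmx X (fun q => f q *: A q) p = 'D_X f p *: A p + f p *: dmx X A p.
Proof.
move=> sf sA Op; apply/matrixP => i j; rewrite mxE dmxE !mxE.
have -> : (fun q => (f q *: A q) i j) = f * (fun q => A q i j).
  by apply/funext => q; rewrite mxE.
rewrite deriveM; first last.
- exact: smooth_mx_derivable.
- exact/diff_derivable/(smooth_on_diff sf Op).
- by rewrite addrC dmxE; congr (_ + _); rewrite mulrC.
Qed.

Lemma smooth_mxT a b (A : 'rV[R]_n -> 'M[R]_(a, b)) :
  smooth_mx O A -> smooth_mx O (fun q => (A q)^T).
Proof.
move=> sA i j; apply: (smooth_on_eq (U := O) (F := fun q => A q j i)) => //.
by move=> q _; rewrite mxE.
Qed.

Lemma dmxT a b X (A : 'rV[R]_n -> 'M[R]_(a, b)) p :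
  dmx X (fun q => (A q)^T) p = (dmx X A p)^T.
Proof.
apply/matrixP => i j; rewrite mxE !dmxE.
by have -> : (fun q => (A q)^T i j) = (fun q => A q j i)
  by apply/funext => q; rewrite mxE.
Qed.

Lemma smooth_mxN a b (A : 'rV[R]_n -> 'M[R]_(a, b)) :
  smooth_mx O A -> smooth_mx O (fun q => - A q).
Proof.
move=> sA; apply: (@smooth_mx_eq _ _ (fun q => -1 *: A q)) => [q _|].
  by rewrite scaleN1r.
by apply: smooth_mxZ => //; exact: smooth_on_cst.
Qed.

Lemma dmxN a b X (A : 'rV[R]_n -> 'M[R]_(a, b)) p :
  smooth_mx O A -> O p -> dmx X (fun q => - A q) p = - dmx X A p.
Proof.
move=> sA Op; rewrite (@dmx_eq _ _ _ _ (fun q => -1 *: A q)) //; last first.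
  by move=> q _; rewrite scaleN1r.
rewrite dmxZ //; last exact: smooth_on_cst.
by rewrite derive_cst scale0r add0r scaleN1r.
Qed.

Lemma smooth_mxB a b (A B : 'rV[R]_n -> 'M[R]_(a, b)) :
  smooth_mx O A -> smooth_mx O B -> smooth_mx O (fun q => A q - B q).
Proof. by move=> sA sB; apply: smooth_mxD => //; exact: smooth_mxN. Qed.

Lemma dmxB a b X (A B : 'rV[R]_n -> 'M[R]_(a, b)) p :
  smooth_mx O A -> smooth_mx O B -> O p ->
  dmx X (fun q => A q - B q) p = dmx X A p - dmx X B p.
Proof.
by move=> sA sB Op; rewrite dmxD ?dmxN //; exact: smooth_mxN.
Qed.

Lemma smooth_dmx a b X (A : 'rV[R]_n -> 'M[R]_(a, b)) :
  smooth_mx O A -> smooth_mx O (dmx X A).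
Proof.
move=> sA i j.
apply: (smooth_on_eq (U := O) (F := 'D_X (fun q => A q i j))) => //.
  by move=> q _; rewrite dmxE.
exact: (smooth_on_dir _ oO (sA i j)).
Qed.

Lemma dmx_schwarz a b X Y (A : 'rV[R]_n -> 'M[R]_(a, b)) p :
  smooth_mx O A -> O p -> dmx X (dmx Y A) p = dmx Y (dmx X A) p.
Proof.
move=> sA Op; apply/matrixP => i j; rewrite !dmxE.
have E Z : (fun q => dmx Z A q i j) = 'D_Z (fun q => A q i j).
  by apply/funext => q; rewrite dmxE.
by rewrite !E (schwarz X Y oO Op (sA i j)).
Qed.

Lemma dmx_dir a b X (A : 'rV[R]_n -> 'M[R]_(a, b)) p :
  smooth_mx O A -> O p ->
  dmx X A p = \sum_i X 0 i *: dmx (basis_vec R i) A p.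
Proof.
move=> sA Op; apply/matrixP => i j; rewrite summxE dmxE.
rewrite (derive_dir _ (smooth_on_diff (sA i j) Op)).
by apply: eq_bigr => k _; rewrite mxE dmxE.
Qed.

Lemma smooth_det a (A : 'rV[R]_n -> 'M[R]_a) :
  smooth_mx O A -> smooth_on O (fun q => \det (A q)).
Proof.
move=> sA; apply: smooth_on_sum => // s; apply: smooth_onM => //.
  exact: smooth_on_cst.
by apply: smooth_on_prod => // i; exact: sA.
Qed.

Lemma smooth_invmx a (A : 'rV[R]_n -> 'M[R]_a) :
  (forall q, O q -> A q \in unitmx) -> smooth_mx O A ->
  smooth_mx O (fun q => invmx (A q)).
Proof.
move=> uA sA.
apply: (@smooth_mx_eq _ _ (fun q => (\det (A q))^-1 *: \adj (A q))) => [q Oq|].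
  by rewrite /invmx uA.
apply: smooth_mxZ.
  apply: smooth_onV => // [q Oq|]; last exact: smooth_det.
  by have := uA q Oq; rewrite unitmxE unitfE.
move=> i j; apply: (smooth_on_eq (U := O)
  (F := fun q => (-1) ^+ (j + i) * \det (row' j (col' i (A q))))) => //.
  by move=> q _; rewrite mxE.
apply: smooth_onM => //; first exact: smooth_on_cst.
apply: smooth_det => k l.
apply: (smooth_on_eq (U := O) (F := fun q => A q (lift j k) (lift i l))) => //.
by move=> q _; rewrite !mxE.
Qed.

End Rules.

Lemma smooth_mx_subset a b O O' (A : 'rV[R]_n -> 'M[R]_(a, b)) :
  open O' -> O' `<=` O -> smooth_mx O A -> smooth_mx O' A.
Proof. by move=> oO' sOO sA i j; exact: smooth_on_subset (sA i j). Qed.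

End MatrixCalculus.

(** * Unique continuation for linear differential inequalities *)

(** The sign pattern is that of the components of xi /\ u and u /\ u; the lemma contracts one index
    of such a three-term expression with [cc]. *)
Lemma sum_lin3 (R : realType) (I : finType) (cc E1 E2 E3 : I -> R) (a b c : R) :
  \sum_l cc l * (a * E1 l - b * E2 l + c * E3 l) =
  a * (\sum_l cc l * E1 l) - b * (\sum_l cc l * E2 l) + c * (\sum_l cc l * E3 l).
Proof.
by rewrite !mulr_sumr -sumrB -big_split; apply: eq_bigr => l _ /=; ring.
Qed.

Section Gronwall.
Variables (R : realType) (n : nat).
Implicit Types (O D : set 'rV[R]_n) (X p q : 'rV[R]_n).

Lemma derive_bigsum (I : Type) (r : seq I) (O : set 'rV[R]_n)
    (F : I -> 'rV[R]_n -> R) X q :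
  open O -> (forall i, smooth_on O (F i)) -> O q ->
  'D_X (fun z => \sum_(i <- r) F i z) q = \sum_(i <- r) 'D_X (F i) q.
Proof.
move=> oO sF Oq; elim: r => [|i r IH].
  have -> : (fun z => \sum_(i <- [::]) F i z) = cst 0.
    by apply/funext => z; rewrite big_nil.
  by rewrite derive_cst big_nil.
have -> : (fun z => \sum_(j <- i :: r) F j z) = F i + (fun z => \sum_(j <- r) F j z).
  by apply/funext => z; rewrite big_cons.
rewrite deriveD ?big_cons ?IH //.
  exact/diff_derivable/(smooth_on_diff (sF i) Oq).
by apply/diff_derivable/(smooth_on_diff _ Oq); exact: smooth_on_sum.
Qed.

(** Cauchy-Schwarz against the constant family 1, by summing
    [a i * a j <= (a i ^+ 2 + a j ^+ 2) / 2]. *)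
Lemma sqr_sum_le (I : finType) (a : I -> R) :
  (\sum_i a i) ^+ 2 <= #|I|%:R * \sum_i a i ^+ 2.
Proof.
have -> : #|I|%:R * \sum_i a i ^+ 2 = \sum_i \sum_j (a i ^+ 2 + a j ^+ 2) / 2.
  apply/esym; rewrite (eq_bigr (fun i => #|I|%:R * (a i ^+ 2 / 2) + (\sum_j a j ^+ 2) / 2)); last first.
    by move=> i _; rewrite -mulr_suml big_split /= sumr_const mulrDl;
      rewrite -[X in X / 2 + _]mulr_natl -mulrA.
  rewrite big_split /= sumr_const -mulr_sumr -mulr_suml -mulr_natl.
  by move: (\sum_j _) => s; field.
rewrite expr2 mulr_suml; apply: ler_sum => i _; rewrite mulr_sumr.
apply: ler_sum => j _; have := sqr_ge0 (a i - a j).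
by rewrite sqrrB; move: (a i * a j) (a i ^+ 2) (a j ^+ 2) => x y z; lra.
Qed.

(** Gronwall's argument on the segment from [q0] to [q1], which stays in the ball by convexity. It
    is run on the sum of squares [G], which is differentiable, unlike the sum of absolute values. *)
Lemma zero_propagates_line (I : finType) O (F : I -> 'rV[R]_n -> R) (p : 'rV[R]_n) (r C : R) :
  open O -> ball p r `<=` O -> (forall b, smooth_on O (F b)) -> 0 <= C ->
  (forall q b i, ball p r q ->
     `|partial i (F b) q| <= C * \sum_c `|F c q|) ->
  forall q0 q1, ball p r q0 -> ball p r q1 ->
  (forall b, F b q0 = 0) -> forall b, F b q1 = 0.
Proof.
move=> oO BO sF C0 Fb q0 q1 B0 B1 F0.
pose X := q1 - q0.
have Bt (t : R) : 0 <= t <= 1 -> ball p r (q0 + t *: X).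
  move=> /andP[t0 t1]; move: B0 B1; rewrite -!ball_normE /= => B0 B1.
  have -> : p - (q0 + t *: X) = (1 - t) *: (p - q0) + t *: (p - q1).
    rewrite /X scalerBl scale1r !scalerBr.
    by apply/matrixP => i j; rewrite !mxE; ring.
  apply: (le_lt_trans (ler_normD _ _)); rewrite !normrZ ger0_norm ?subr_ge0 //.
  rewrite (ger0_norm t0).
  (* The strict inequality comes from [q0] when [t = 0], and from [q1] otherwise. *)
  have [->|t0'] := eqVneq t 0; first by rewrite subr0 mul1r mul0r addr0.
  have : t * `|p - q1| < t * r by rewrite ltr_pM2l // lt_neqAle eq_sym t0'.
  have : (1 - t) * `|p - q0| <= (1 - t) * r by rewrite ler_wpM2l ?subr_ge0 // ltW.
  by move: `|p - q0| `|p - q1| => x y; lra.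
pose G q := \sum_b F b q * F b q.
have sG : smooth_on O G by apply: smooth_on_sum => // b; exact: smooth_onM.
pose C' := C * \sum_i `|X 0 i|.
have C'0 : 0 <= C' by rewrite mulr_ge0 // sumr_ge0.
have dXF q b : ball p r q -> `|'D_X (F b) q| <= C' * \sum_c `|F c q|.
  move=> Bq; rewrite (derive_dir _ (smooth_on_diff (sF b) (BO _ Bq))).
  apply: (le_trans (ler_norm_sum _ _ _)).
  rewrite /C' -mulrA mulr_suml mulr_sumr; apply: ler_sum => i _.
  by rewrite normrM mulrCA ler_wpM2l // Fb.
(* The 2 comes from differentiating squares, [C'] bounds the derivatives along [X], and the
   cardinality comes from Cauchy-Schwarz. *)
pose K := 2 * C' * #|I|%:R.
have dG q : ball p r q -> 'D_X G q <= K * G q.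
  move=> Bq; rewrite (@derive_bigsum _ _ O) //; last exact: BO.
    under eq_bigr => b _.
      rewrite (_ : (fun z => F b z * F b z) = F b * F b) // deriveM; first last.
      - exact/diff_derivable/(smooth_on_diff (sF b) (BO _ Bq)).
      - exact/diff_derivable/(smooth_on_diff (sF b) (BO _ Bq)).
      over.
    apply: (le_trans (y := 2 * C' * (\sum_c `|F c q|) ^+ 2)).
      rewrite expr2 mulrA [_ * _ * (\sum_c _)]mulrC mulr_suml.
      apply: ler_sum => b _.
      rewrite (_ : _ + _ = 2 * (F b q * 'D_X (F b) q)); last by rewrite -mulr2n mulr_natl.
      rewrite -mulrA [leRHS]mulrCA ler_pM2l //.
      apply: (le_trans (ler_norm _)); rewrite normrM.
      by rewrite ler_wpM2l // dXF.
    rewrite /K -[leRHS]mulrA; apply: ler_wpM2l; first by rewrite mulr_ge0.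
    apply: (le_trans (sqr_sum_le _)); rewrite ler_wpM2l // /G.
    by apply: ler_sum => c _; rewrite real_normK ?num_real // expr2.
  by move=> b; exact: smooth_onM.
(* With this integrating factor, [dG] says that [psi] does not increase on the segment. *)
pose psi (t : R) := G (q0 + t *: X) * expR (- K * t).
have dpsi (t : R) : 0 <= t <= 1 -> is_derive t 1 psi
   (expR (- K * t) * ('D_X G (q0 + t *: X) - K * G (q0 + t *: X))).
  move=> ht.
  have dg := is_derive_line (smooth_on_diff sG (BO _ (Bt t ht))).
  have dl : is_derive t 1 (fun s : R => - K * s) (- K).
    have : is_derive t 1 ((- K) *: (@id R)) ((- K) *: (1 : R)).
      exact: is_deriveZ.
    by rewrite /GRing.scale /= mulr1.
  have de := is_derive1_comp (is_derive_expR (- K * t)) dl.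
  have -> : psi = (fun s : R => G (q0 + s *: X)) * (expR \o *%R (- K)) by [].
  apply: is_derive_eq (is_deriveM dg de) _.
  by rewrite /GRing.scale /=; ring.
have psi1 : psi 1 <= psi 0.
  apply: (@ler0_derive1_le_cc _ psi 0 1).
  - move=> t; rewrite in_itv /= => /andP[t0 t1].
    by have [] := dpsi t; rewrite ?ltW.
  - move=> t; rewrite in_itv /= => /andP[t0 t1].
    have ht : 0 <= t <= 1 by rewrite !ltW.
    rewrite derive1E (@derive_val _ _ _ _ _ _ _ (dpsi t ht)).
    by rewrite pmulr_rle0 ?expR_gt0 // subr_le0; apply/dG/Bt.
  - apply: derivable_within_continuous => t; rewrite in_itv /= => ht.
    by have [] := dpsi t ht.
  - by rewrite in_itv /= lexx ler01.
  - by rewrite in_itv /= lexx ler01.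
  - exact: ler01.
have G0 : psi 0 = 0.
  rewrite /psi scale0r addr0 (_ : G q0 = 0) ?mul0r //.
  by rewrite /G big1 // => b _; rewrite F0 mul0r.
have G1 : G q1 = 0.
  move: psi1; rewrite G0 /psi scale1r /X addrC subrK.
  rewrite pmulr_lle0 ?expR_gt0 // => G1; apply/eqP; rewrite eq_le G1 /=.
  by apply: sumr_ge0 => b _; rewrite -expr2 sqr_ge0.
move=> b; move/eqP: G1; rewrite psumr_eq0; last by move=> c _; rewrite -expr2 sqr_ge0.
by move=> /allP/(_ b); rewrite mem_index_enum => /(_ isT) /=; rewrite mulf_eq0 orbb => /eqP.
Qed.

End Gronwall.

Lemma near_all (T : topologicalType) (P : T -> Prop) (p : T) :
  (forall q, P q) -> \forall q \near p, P q.
Proof. by move=> H; apply: filterS filterT => q _; exact: H. Qed.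

(** * Local bounds by a reference function *)

Section Domination.
Variables (R : realType) (n : nat) (D : set 'rV[R]_n) (p : 'rV[R]_n).
Implicit Types (m h c : 'rV[R]_n -> R).

(** That is, [h = O(m)] at [p] along [D]. For [m] equal to [fun=> 1] it says that [h] is bounded
    near [p] on [D], the form in which coefficients enter. *)
Definition dominated m h :=
  exists2 C, 0 <= C & \forall q \near p, D q -> `|h q| <= C * m q.

Lemma dominated_eq m h h' : (\forall q \near p, D q -> h q = h' q) ->
  dominated m h -> dominated m h'.
Proof.
move=> hh' [C C0 hC]; exists C => //; apply: filterS2 hh' hC => q E H Dq.
by rewrite -E // H.
Qed.

Lemma dominated0 m : (forall q, 0 <= m q) -> dominated m (fun=> 0).
Proof. by move=> m0; exists 0 => //; apply: near_all => q _; rewrite normr0 mul0r. Qed.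

Lemma dominatedD m h h' : dominated m h -> dominated m h' ->
  dominated m (fun q => h q + h' q).
Proof.
move=> [C C0 hC] [C' C'0 hC']; exists (C + C'); first exact: addr_ge0.
apply: filterS2 hC hC' => q H H' Dq; rewrite mulrDl.
by apply: (le_trans (ler_normD _ _)); apply: lerD; [exact: H|exact: H'].
Qed.

Lemma dominatedN m h : dominated m h -> dominated m (fun q => - h q).
Proof.
by move=> [C C0 hC]; exists C => //; apply: filterS hC => q; rewrite normrN.
Qed.

Lemma dominatedB m h h' : dominated m h -> dominated m h' ->
  dominated m (fun q => h q - h' q).
Proof. by move=> H H'; apply: dominatedD => //; exact: dominatedN. Qed.

Lemma dominatedM m c h : (forall q, 0 <= m q) -> dominated (fun=> 1) c ->
  dominated m h -> dominated m (fun q => c q * h q).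
Proof.
move=> m0 [C C0 hC] [C' C'0 hC']; exists (C * C'); first exact: mulr_ge0.
apply: filterS2 hC hC' => q H H' Dq; rewrite normrM -mulrA.
by have := H Dq; rewrite mulr1 => H1; exact: ler_pM (H' Dq).
Qed.

Lemma dominated_sum m (I : Type) (r : seq I) (h : I -> 'rV[R]_n -> R) :
  (forall q, 0 <= m q) -> (forall i, dominated m (h i)) ->
  dominated m (fun q => \sum_(i <- r) h i q).
Proof.
move=> m0 H; elim: r => [|i r IH].
  by apply: dominated_eq (dominated0 m0); apply: near_all => q _; rewrite big_nil.
apply: dominated_eq (dominatedD (H i) IH).
by apply: near_all => q _; rewrite big_cons.
Qed.

Lemma continuous_dominated c : {for p, continuous c} -> dominated (fun=> 1) c.
Proof.
move=> cc; exists (`|c p| + 1); first by rewrite addr_ge0.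
have H : \forall q \near p, `|c p - c q| < 1 by exact: cvgr_dist_lt cc _ ltr01.
apply: filterS H => q H _; rewrite mulr1 -[c q](subKr (c p)).
by apply: (le_trans (ler_normB _ _)); rewrite lerD2l ltW.
Qed.

Lemma dominated_term (I : finType) (F : I -> 'rV[R]_n -> R) b :
  dominated (fun q => \sum_c `|F c q|) (F b).
Proof.
exists 1 => //; apply: near_all => q _; rewrite mul1r (bigD1 b) //= lerDl.
exact: sumr_ge0.
Qed.

Lemma dominated_abs m h : dominated m h -> dominated m (fun q => `|h q|).
Proof.
by move=> [C C0 hC]; exists C => //; apply: filterS hC => q; rewrite normr_id.
Qed.

End Domination.

Section Propagation.
Variables (R : realType) (n : nat).
Implicit Types (O D : set 'rV[R]_n) (p q : 'rV[R]_n).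

Lemma continuous_sum_norm (I : Type) (r : seq I) (F : I -> 'rV[R]_n -> R) q :
  (forall i, {for q, continuous (F i)}) ->
  {for q, continuous (fun z => \sum_(i <- r) `|F i z|)}.
Proof.
move=> cF; elim: r => [|i r IH].
  have -> : (fun z => \sum_(i <- [::]) `|F i z|) = cst 0.
    by apply/funext => z; rewrite big_nil.
  exact: cst_continuous.
have -> : (fun z => \sum_(j <- i :: r) `|F j z|) =
   (fun z => `|F i z|) \+ (fun z => \sum_(j <- r) `|F j z|).
  by apply/funext => z; rewrite big_cons.
apply: continuousD => //; apply: continuous_comp (cF i) _.
exact: norm_continuous.
Qed.

(* The inequalities are only assumed on a dense set [D], typically where [xi] does
   not vanish, and extend to [O] by continuity. *)
Lemma zero_propagates (I : finType) O D (F : I -> 'rV[R]_n -> R) p :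
  open O -> O p -> O `<=` closure D -> (forall b, smooth_on O (F b)) ->
  (forall b i, dominated D p (fun q => \sum_c `|F c q|) (partial i (F b))) ->
  exists2 r, 0 < r & ball p r `<=` O /\
    forall q0 q1, ball p r q0 -> ball p r q1 ->
    (forall b, F b q0 = 0) -> forall b, F b q1 = 0.
Proof.
move=> oO Op OD sF Hd.
pose m q : R := \sum_c `|F c q|.
have m0 q : 0 <= m q by exact: sumr_ge0.
have /choice[CC hCC] : forall bi : I * 'I_n, exists C, 0 <= C /\
    \forall q \near p, D q -> `|partial bi.2 (F bi.1) q| <= C * m q.
  by move=> [b i]; have [C C0 hC] := Hd b i; exists C.
pose C := \sum_bi CC bi.
have C0 : 0 <= C by apply: sumr_ge0 => bi _; have [] := hCC bi.
have H1 : \forall q \near p, forall bi : I * 'I_n,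
    D q -> `|partial bi.2 (F bi.1) q| <= C * m q.
  apply: (@filter_forall _ _ _ (nbhs p)) => bi; have [Cb0 hC] := hCC bi.
  apply: filterS hC => q H Dq; apply: (le_trans (H Dq)).
  rewrite ler_wpM2r // /C (bigD1 bi) //= lerDl.
  by apply: sumr_ge0 => c _; have [] := hCC c.
have /nbhs_ballP[r /= r0 Hr] : \forall q \near p, O q /\ forall bi : I * 'I_n,
    D q -> `|partial bi.2 (F bi.1) q| <= C * m q.
  by apply: filterI H1; exact: (open_nbhs_nbhs (conj oO Op)).
exists r => //; split=> [q Bq|]; first by have [] := Hr q Bq.
have BO : ball p r `<=` O by move=> q Bq; have [] := Hr q Bq.
apply: (zero_propagates_line oO BO sF C0) => q b i Bq.
(* A strict violation is an open condition, so it would also occur at a point of [D]. *)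
rewrite leNgt; apply/negP => lt_m.
have Oq := BO q Bq.
have c1 : {for q, continuous (fun z => `|partial i (F b) z| - C * m z)}.
  apply: continuousB.
    apply: (@continuous_comp _ _ _ (partial i (F b)) Num.norm).
      exact: (smooth_on_cont (smooth_on_partial i (sF b)) Oq).
    exact: norm_continuous.
  apply: continuousM; first exact: cst_continuous.
  by apply: continuous_sum_norm => c; exact: (smooth_on_cont (sF c) Oq).
have H2 : \forall z \near q, 0 < `|partial i (F b) z| - C * m z.
  by apply: (cvgr_gt _ c1); rewrite subr_gt0.
have H3 : \forall z \near q, ball p r z.
  apply: (open_nbhs_nbhs (conj _ Bq)); exact: ball_open.
have [z [Dz [H4 Bz]]] := OD q Oq _ (filterI H2 H3).
have [_ /(_ (b, i) Dz) /=] := Hr z Bz.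
by rewrite leNgt -subr_gt0 H4.
Qed.

Definition dominated_mx a b D p (m : 'rV[R]_n -> R) (B : 'rV[R]_n -> 'M[R]_(a, b)) :=
  forall i j, dominated D p m (fun q => B q i j).

Section DominatedMatrices.
Variables (O D : set 'rV[R]_n) (oO : open O) (p : 'rV[R]_n) (Op : O p).
Variables (m : 'rV[R]_n -> R) (m0 : forall q, 0 <= m q).

Lemma dominated_mx_eq a b (B C : 'rV[R]_n -> 'M[R]_(a, b)) :
  (forall q, O q -> D q -> B q = C q) -> dominated_mx D p m B -> dominated_mx D p m C.
Proof.
move=> BC dB i j; apply: dominated_eq (dB i j).
by apply: near_open Op _ => // q Oq Dq; rewrite BC.
Qed.

Lemma dominated_mxD a b (B C : 'rV[R]_n -> 'M[R]_(a, b)) :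
  dominated_mx D p m B -> dominated_mx D p m C -> dominated_mx D p m (fun q => B q + C q).
Proof.
move=> dB dC i j; apply: dominated_eq (dominatedD (dB i j) (dC i j)).
by apply: near_all => q _; rewrite mxE.
Qed.

Lemma dominated_mxN a b (B : 'rV[R]_n -> 'M[R]_(a, b)) :
  dominated_mx D p m B -> dominated_mx D p m (fun q => - B q).
Proof.
move=> dB i j; apply: dominated_eq (dominatedN (dB i j)).
by apply: near_all => q _; rewrite mxE.
Qed.

Lemma dominated_mxT a b (B : 'rV[R]_n -> 'M[R]_(a, b)) :
  dominated_mx D p m B -> dominated_mx D p m (fun q => (B q)^T).
Proof.
move=> dB i j; apply: dominated_eq (dB j i).
by apply: near_all => q _; rewrite mxE.
Qed.

Lemma smooth_dominated (h : 'rV[R]_n -> R) :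
  smooth_on O h -> dominated D p (fun=> 1) h.
Proof. by move=> sh; apply: continuous_dominated; exact: smooth_on_cont sh Op. Qed.

Lemma dominated_mxMl a b c (C : 'rV[R]_n -> 'M[R]_(a, b)) (B : 'rV[R]_n -> 'M[R]_(b, c)) :
  smooth_mx O C -> dominated_mx D p m B -> dominated_mx D p m (fun q => C q *m B q).
Proof.
move=> sC dB i j.
apply: (@dominated_eq _ _ _ _ _ (fun q => \sum_k C q i k * B q k j)).
  by apply: near_all => q _; rewrite mxE.
apply: dominated_sum => // k.
apply: (@dominatedM _ _ _ _ _ (fun q => C q i k) (fun q => B q k j)) => //.
exact/smooth_dominated/sC.
Qed.

Lemma dominated_mxMr a b c (B : 'rV[R]_n -> 'M[R]_(a, b)) (C : 'rV[R]_n -> 'M[R]_(b, c)) :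
  smooth_mx O C -> dominated_mx D p m B -> dominated_mx D p m (fun q => B q *m C q).
Proof.
move=> sC dB.
apply: (@dominated_mx_eq _ _ (fun q => ((C q)^T *m (B q)^T)^T)) => [q _ _|].
  by rewrite trmx_mul !trmxK.
apply/dominated_mxT/dominated_mxMl; last exact: dominated_mxT.
exact: smooth_mxT.
Qed.

Lemma dominated_mxZ a b (h : 'rV[R]_n -> R) (B : 'rV[R]_n -> 'M[R]_(a, b)) :
  dominated D p (fun=> 1) h -> dominated_mx D p m B ->
  dominated_mx D p m (fun q => h q *: B q).
Proof.
move=> dh dB i j; apply: dominated_eq (dominatedM m0 dh (dB i j)).
by apply: near_all => q _; rewrite mxE.
Qed.

End DominatedMatrices.

End Propagation.

(** * Pointwise curvature algebra *)

Section CurvatureAlgebra.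
Variables (R : realType) (n : nat).
Implicit Types X Y Z W : 'rV[R]_n.

Definition bil (G : 'M[R]_n) X Y : R := (X *m G *m Y^T) 0 0.

Lemma bil_sym (G : 'M[R]_n) X Y : G^T = G -> bil G X Y = bil G Y X.
Proof.
move=> sG; rewrite /bil -[in LHS](trmxK (X *m G *m Y^T)) mxE.
by rewrite !trmx_mul trmxK sG mulmxA.
Qed.

Lemma common_kernel3 (c1 c2 c3 : 'cV[R]_n) : (3 < n)%N ->
  exists2 Z : 'rV[R]_n, Z != 0 &
    [/\ (Z *m c1) 0 0 = 0, (Z *m c2) 0 0 = 0 & (Z *m c3) 0 0 = 0].
Proof.
move=> n3; pose C : 'M[R]_(n, 1 + (1 + 1)) := row_mx c1 (row_mx c2 c3).
have rC : (\rank C < n)%N by apply: leq_ltn_trans (rank_leq_col C) _.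
have K0 : kermx C != 0 by rewrite -mxrank_eq0 mxrank_ker subn_eq0 -ltnNge.
have /rowV0Pn[Z ZK Z0] := K0.
exists Z => //; have : Z *m C = 0 by apply/sub_kermxP.
rewrite /C !mul_mx_row => /eqP; rewrite row_mx_eq0 row_mx_eq0.
by case/and3P => /eqP -> /eqP -> /eqP ->; rewrite !mxE.
Qed.

(** A model at one point: [G] is the metric, [A] the endomorphism nabla xi, [dv] the differential of
    [f], and [K] the curvature, with the sign of [curv4] below. [K_xi] is the Ricci identity for xi
    and [K_u] the one for u, after inserting nabla_X u = f X /\ xi. *)
Variables (G A : 'M[R]_n) (xi : 'rV[R]_n) (dv : 'cV[R]_n) (f : R).
Variable K : 'rV[R]_n -> 'rV[R]_n -> 'rV[R]_n -> 'rV[R]_n -> R.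
Local Notation b := (bil G).
Local Notation x Z := (b Z xi).
Local Notation u X Y := (b (X *m A) Y).
Local Notation d Z := ((Z *m dv) 0 0).
Hypothesis n_gt3 : (3 < n)%N.
Hypothesis G_sym : G^T = G.
Hypothesis G_pos : forall X, X != 0 -> 0 < b X X.
Hypothesis u_skew : forall X Y, u X Y = - u Y X.
Hypothesis K_skew : forall X Y Z W, K X Y Z W = - K X Y W Z.
Hypothesis K_pair : forall X Y Z W, K X Y Z W = K Z W X Y.
Hypothesis K_xi : forall X Y Z, K X Y Z xi = f * (b Y Z * x X - b X Z * x Y).
Hypothesis K_0 : forall X Y W, K X Y 0 W = 0.
Hypothesis K_u : forall X Y Z W,
  - (K X Y Z (W *m A) + K X Y (Z *m A) W) =
    d X * (b Y Z * x W - b Y W * x Z) - d Y * (b X Z * x W - b X W * x Z)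
    + f * (b Y Z * u X W - b Y W * u X Z - b X Z * u Y W + b X W * u Y Z).

Local Notation eta := (xi *m A).
Local Notation e Z := (b Z eta).
Local Notation N := (x xi).
Local Notation Q X Y := (N * b X Y - x X * x Y).

Let b_sym X Y : b X Y = b Y X. Proof. exact: bil_sym. Qed.

Let x_eta : x eta = 0.
Proof. by have := u_skew xi xi; lra. Qed.

Let u_xi X : u X xi = - e X.
Proof. by rewrite u_skew (b_sym X). Qed.

(** This is [K_u] at [Z = xi]: there one of the two curvature terms has xi as an argument and is
    given by [K_xi]. *)
Let K_eta X Y W :
  K X Y eta W = d X * Q Y W - d Y * Q X W + f * (b X W * e Y - b Y W * e X).
Proof.
have := K_u X Y xi W; rewrite K_skew K_xi !u_xi (b_sym X (W *m A)) (b_sym Y (W *m A)).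
by rewrite (u_skew W X) (u_skew W Y); lra.
Qed.

(* [K] minus [f] times the curvature tensor of the unit sphere annihilates [xi] and
   commutes with [u] up to terms in [d]. Evaluated on [eta = u xi], this makes [d] a
   multiple of [e], and then, by pair symmetry, determines [u] completely once a
   vector orthogonal to [xi], [eta] and [u eta] is inserted; it exists as [3 < n]. *)
Lemma twistor_rigidity : (exists X, d X != 0) -> xi != 0 ->
  0 < e eta /\ forall X Y, N * u X Y = x X * e Y - e X * x Y.
Proof.
case=> X0 dX0 xi0.
have N0 : 0 < N by exact: G_pos.
(* Take [W = eta] in [K_eta]: the left-hand side vanishes by skew-symmetry and the terms in [f]
   cancel. *)
have de X Y : d X * e Y = d Y * e X.
  have := K_eta X Y eta; rewrite (_ : K X Y eta eta = 0); last first.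
    by have := K_skew X Y eta eta; lra.
  rewrite x_eta !mulr0 !subr0 (mulrC (e X)) subrr mulr0 addr0 => /esym H.
  apply: (mulfI (lt0r_neq0 N0)); rewrite !mulrA ![N * _]mulrC -!mulrA.
  by move: H => /eqP; rewrite subr_eq0 => /eqP.
(* Otherwise [K_eta] at [X0], [Z], [Z], with [Z] orthogonal to xi and in the kernel of [d], would
   read [d X0 * N * b Z Z = 0]. *)
have eta0 : eta != 0.
  apply/negP => /eqP eta0.
  have [Z Z0 [Zx Zd _]] := common_kernel3 (G *m xi^T) dv 0 n_gt3.
  have Zx' : x Z = 0 by rewrite /bil -mulmxA.
  have bz : 0 < b Z Z by exact: G_pos.
  have e0 W : e W = 0 by rewrite eta0 /bil trmx0 mulmx0 mxE.
  have := K_eta X0 Z Z; rewrite Zx' Zd !e0 eta0 K_0.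
  rewrite !mulr0 !mul0r !subr0 mulr0 addr0 => /esym/eqP.
  by rewrite !mulf_eq0 (negPf dX0) !gt_eqF.
have E0 : 0 < e eta by exact: G_pos.
split=> //.
pose l := d eta / e eta.
have dl X : d X = l * e X.
  by rewrite /l mulrAC -de mulfK // gt_eqF.
have l0 : l != 0.
  by apply: contraNneq dX0 => l0; rewrite dl l0 mul0r.
(* [h W] is minus the inner product of u eta with [W], so [a = 0] will mean that u eta is a multiple
   of xi; the factor is forced by [W = xi]. *)
pose h W := u W eta.
pose a W := N * h W - e eta * x W.
(* Apply [K_u] with first argument [eta]; pair symmetry moves [eta] to the third slot, where [K_eta]
   evaluates both curvature terms. The terms in [f] cancel, and the rest is divisible by [l]. *)
have main Y Z W : N * (e Z * u W Y - e W * u Z Y) - a W * b Z Y + a Z * b W Y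
   + (h W * x Z - h Z * x W) * x Y - (e Z * x W - e W * x Z) * e Y = 0.
  have := K_u eta Y Z W.
  rewrite (K_pair eta Y Z) (K_pair eta Y (Z *m A)) !K_eta !dl !u_xi.
  rewrite (b_sym Y Z) (b_sym Y W) (b_sym eta Z) (b_sym eta W).
  rewrite (u_skew eta W) (u_skew eta Z) (u_skew Y W) (u_skew Y Z).
  rewrite -/(h W) -/(h Z) /a => H; apply: (mulfI l0); lra.
have [Z Z0 [Zx Ze Zh]] := common_kernel3 (G *m xi^T) (G *m eta^T) (A *m G *m eta^T) n_gt3.
have Zx' : x Z = 0 by rewrite /bil -mulmxA.
have Ze' : e Z = 0 by rewrite /bil -mulmxA.
have Zh' : h Z = 0 by rewrite /h /bil -!mulmxA; rewrite -mulmxA in Zh.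
have a0 W : a W = 0.
  have := main Z Z W; rewrite /a Zx' Ze' Zh'.
  have -> : u Z Z = 0 by have := u_skew Z Z; lra.
  have bz : b Z Z != 0 by rewrite gt_eqF // G_pos.
  by rewrite -/(a W) => H; apply: (mulIf bz); lra.
have hx W : h W = e eta * x W / N.
  have := a0 W; rewrite /a => H; apply: (mulIf (lt0r_neq0 N0)).
  by rewrite divfK ?gt_eqF //; lra.
(* At [Z = eta], with [a = 0], the only unknown term left is [N * e eta * u W Y]. *)
move=> W Y; have := main Y eta W; rewrite !a0 x_eta.
have -> : h eta = 0 by rewrite hx x_eta mulr0 mul0r.
have -> : u eta Y = - h Y by rewrite u_skew.
rewrite hx => H; apply: (mulfI (lt0r_neq0 E0)).
have NE : N * (e eta * x Y / N) = e eta * x Y by rewrite mulrC divfK // gt_eqF.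
have : e W * (N * (e eta * x Y / N)) = e W * (e eta * x Y) by rewrite NE.
lra.
Qed.

End CurvatureAlgebra.

(** * Killing fields in a chart *)

(** Unlike [mxE], these three rules do not open products, which [ring] can then treat as atoms in
    [matrix_abelian]. *)
Lemma addmx_entry (R : realType) a b (A B : 'M[R]_(a, b)) i j :
  (A + B) i j = A i j + B i j.
Proof. by rewrite mxE. Qed.

Lemma oppmx_entry (R : realType) a b (A : 'M[R]_(a, b)) i j : (- A) i j = - A i j.
Proof. by rewrite mxE. Qed.

Lemma zeromx_entry (R : realType) a b i j : (0 : 'M[R]_(a, b)) i j = 0.
Proof. by rewrite mxE. Qed.

Ltac matrix_abelian :=
  apply/matrixP => ? ?; rewrite !(addmx_entry, oppmx_entry, zeromx_entry); ring.

Lemma tr_add (R : realType) a b (A B : 'M[R]_(a, b)) : (A + B)^T = A^T + B^T.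
Proof. by rewrite linearD. Qed.

Lemma tr_opp (R : realType) a b (A : 'M[R]_(a, b)) : (- A)^T = - A^T.
Proof. by rewrite linearN. Qed.

Section LocalGeometry.
Variables (R : realType) (n : nat).
Variables (O : set 'rV[R]_n) (oO : open O).
Variables (g : 'rV[R]_n -> 'M[R]_n) (xi : 'rV[R]_n -> 'rV[R]_n).
Hypothesis g_smooth : smooth_on O g.
Hypothesis g_sym : forall q, O q -> (g q)^T = g q.
Hypothesis g_pos : forall q, O q -> forall X, X != 0 -> 0 < bil (g q) X X.
Hypothesis xi_smooth : smooth_on O xi.
Hypothesis xi_killing : forall q, O q -> lie_metric g xi q = 0.
Implicit Types X Y Z W p q : 'rV[R]_n.

(** * Levi-Civita connection and curvature in the chart *)

Lemma smooth_gram : smooth_mx O g. Proof. exact: smooth_on_smooth_mx. Qed.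
Lemma smooth_field : smooth_mx O xi. Proof. exact: smooth_on_smooth_mx. Qed.

Lemma gram_unit q : O q -> g q \in unitmx.
Proof.
move=> Oq; rewrite -row_free_unit -kermx_eq0; apply/negPn/negP => /rowV0Pn[Z ZK Z0].
have Zg : Z *m g q = 0 by apply/sub_kermxP.
by have := g_pos Oq Z0; rewrite /bil Zg mul0mx mxE ltxx.
Qed.

Lemma partial_coord a b (B : 'rV[R]_n -> 'M[R]_(a, b)) i q : smooth_on O B -> O q ->
  partial i B q = dmx (basis_vec R i) B q.
Proof.
move=> sB Oq; apply/matrixP => k l; rewrite dmxE /partial.
by rewrite derive_mx ?mxE //; exact/diff_derivable/(smooth_on_diff sB Oq).
Qed.

Lemma dgram_sym X q : O q -> (dmx X g q)^T = dmx X g q.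
Proof.
by move=> Oq; rewrite -dmxT; apply: (dmx_eq oO) => // z Oz; exact: g_sym.
Qed.

Let dg i j l q := dmx (basis_vec R i) g q j l.

Let dgC i j l q : O q -> dg i j l q = dg i l j q.
Proof. by move=> Oq; rewrite /dg -[in LHS]dgram_sym // mxE. Qed.

Lemma christoffelE k i j q : O q -> christoffel g k i j q =
  2^-1 * \sum_l invmx (g q) k l * (dg i j l q + dg j i l q - dg l i j q).
Proof.
move=> Oq; rewrite /christoffel; congr (_ * _); apply: eq_bigr => l _.
by rewrite !partial_coord.
Qed.

Lemma christoffel_sym k i j q : O q -> christoffel g k i j q = christoffel g k j i q.
Proof.
move=> Oq; rewrite !christoffelE //; congr (_ * _); apply: eq_bigr => l _.
by rewrite (dgC l i) // [dg i j l q + _]addrC.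
Qed.

(* For a constant row vector [Z], [Z *m conn X q] is nabla_X Z at [q]. *)
Definition conn X q : 'M[R]_n :=
  \matrix_(j, k) \sum_i X 0 i * christoffel g k i j q.

Lemma smooth_christoffel k i j : smooth_on O (christoffel g k i j).
Proof.
apply: smooth_onM => //; first exact: smooth_on_cst.
apply: smooth_on_sum => // l.
have sp a b c : smooth_on O (fun q => partial a g q b c).
  by apply: smooth_on_coord => //; exact: smooth_on_partial.
apply: smooth_onM => //.
  by apply: smooth_invmx => //; [exact: gram_unit|exact: smooth_gram].
by apply: smooth_onB => //; exact: smooth_onD.
Qed.

Lemma smooth_conn X : smooth_mx O (conn X).
Proof.
move=> j k; apply: (smooth_on_eq (U := O)
   (F := fun q => \sum_i X 0 i * christoffel g k i j q)) => //.
  by move=> q _; rewrite mxE.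
apply: smooth_on_sum => // i; apply: smooth_onM => //.
  exact: smooth_on_cst.
exact: smooth_christoffel.
Qed.

(** Torsion-freeness, for constant fields, whose bracket is zero. *)
Lemma conn_sym X Y q : O q -> Y *m conn X q = X *m conn Y q.
Proof.
move=> Oq; apply/rowP => k; rewrite !mxE.
under eq_bigr do rewrite mxE mulr_sumr.
under [RHS]eq_bigr do rewrite mxE mulr_sumr.
rewrite exchange_big; apply: eq_bigr => i _; apply: eq_bigr => j _.
by rewrite mulrCA (christoffel_sym _ _ _ Oq).
Qed.

(** The Koszul formula for constant fields, in matrix form. *)
Lemma koszul X q : O q -> conn X q *m g q = 2^-1 *: (dmx X g q
  + \matrix_(j, l) (X *m dmx (basis_vec R j) g q) 0 l
  - (\matrix_(j, l) (X *m dmx (basis_vec R j) g q) 0 l)^T).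
Proof.
move=> Oq; set S := (_ - _ in RHS).
have ginv_sym : (invmx (g q))^T = invmx (g q) by rewrite trmx_inv g_sym.
suff -> : conn X q = 2^-1 *: (S *m invmx (g q)).
  by rewrite -scalemxAl mulmxKV // gram_unit.
apply/matrixP => j k; rewrite !mxE mulr_sumr.
under eq_bigr do rewrite christoffelE // mulrCA.
rewrite -!mulr_sumr; congr (_ * _).
under eq_bigr do rewrite mulr_sumr.
rewrite exchange_big; apply: eq_bigr => l _.
have -> : invmx (g q) k l = invmx (g q) l k by rewrite -{1}ginv_sym mxE.
under eq_bigr do rewrite mulrCA.
rewrite -mulr_sumr mulrC; congr (_ * _).
rewrite /S (dmx_dir _ smooth_gram Oq) !mxE summxE -!big_split -sumrB /=.
apply: eq_bigr => i _; rewrite !mxE -/(dg i j l q) -/(dg j i l q) -/(dg l i j q).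
by rewrite mulrBr mulrDr.
Qed.

(** In the Koszul formula the derivative of [g] along [X] is the symmetric part; the remainder is
    skew and cancels against its transpose. *)
Lemma conn_metric X q : O q -> dmx X g q = conn X q *m g q + g q *m (conn X q)^T.
Proof.
move=> Oq.
have -> : g q *m (conn X q)^T = (conn X q *m g q)^T by rewrite trmx_mul g_sym.
rewrite koszul //; have := dgram_sym X Oq.
move: (dmx X g q) (\matrix_(j, l) _) => M P sM.
by apply/matrixP => i j; have := congr1 (fun B : 'M[R]_n => B i j) sM; rewrite !mxE => ->; field.
Qed.

(* [Dmx X] is nabla_X on bilinear forms, [Drow X] on 1-forms. In [Dmx X (Dmx Y B)]
   the vector [Y] is constant rather than parallel; as constant fields commute, this
   does not affect the Ricci identities below. *)
Definition Dmx X (B : 'rV[R]_n -> 'M[R]_n) q : 'M[R]_n :=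
  dmx X B q - conn X q *m B q - B q *m (conn X q)^T.

Definition Drow X (r : 'rV[R]_n -> 'rV[R]_n) q : 'rV[R]_n :=
  dmx X r q - r q *m (conn X q)^T.

(** On row vectors this is nabla_Y nabla_X - nabla_X nabla_Y. With this sign the curvature enters
    the Ricci identities for covariant tensors, below, with a plus. *)
Definition curv X Y q : 'M[R]_n :=
  dmx Y (conn X) q - dmx X (conn Y) q + conn X q *m conn Y q - conn Y q *m conn X q.

Ltac smooth_tac := repeat first [ assumption | exact: smooth_gram
  | exact: smooth_field | exact: smooth_conn | exact: smooth_mx_cst
  | apply: smooth_mxB | apply: smooth_mxD | apply: smooth_mxM | apply: smooth_mxT
  | apply: smooth_dmx ].

Lemma smooth_Dmx X B : smooth_mx O B -> smooth_mx O (Dmx X B).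
Proof. by move=> sB; rewrite /Dmx; smooth_tac. Qed.

Lemma smooth_Drow X r : smooth_mx O r -> smooth_mx O (Drow X r).
Proof. by move=> sr; rewrite /Drow; smooth_tac. Qed.

Lemma smooth_curv X Y : smooth_mx O (curv X Y).
Proof. by rewrite /curv; smooth_tac. Qed.

Lemma ricci_mx X Y B q : smooth_mx O B -> O q ->
  Dmx X (Dmx Y B) q - Dmx Y (Dmx X B) q =
  curv X Y q *m B q + B q *m (curv X Y q)^T.
Proof.
move=> sB Oq; rewrite /Dmx /curv.
rewrite !(dmxB oO, dmxM (O := O), dmxT); try by smooth_tac.
rewrite (dmx_schwarz oO X Y sB Oq) !(tr_add, tr_opp, trmx_mul).
rewrite !(mulmxBr, mulmxBl, mulmxDr, mulmxDl, mulmxN, mulNmx, mulmxA, opprD, opprB).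
by matrix_abelian.
Qed.

Lemma ricci_row X Y r q : smooth_mx O r -> O q ->
  Drow X (Drow Y r) q - Drow Y (Drow X r) q = r q *m (curv X Y q)^T.
Proof.
move=> sB Oq; rewrite /Drow /curv.
rewrite !(dmxB oO, dmxM (O := O), dmxT); try by smooth_tac.
rewrite (dmx_schwarz oO X Y sB Oq) !(tr_add, tr_opp, trmx_mul).
rewrite !(mulmxBr, mulmxBl, mulmxDr, mulmxDl, mulmxN, mulNmx, mulmxA, opprD, opprB).
by matrix_abelian.
Qed.

Lemma Dmx_gram X q : O q -> Dmx X g q = 0.
Proof.
by move=> Oq; rewrite /Dmx conn_metric // addrAC addrK subrr.
Qed.

(** The Ricci identity for the parallel tensor [g]. *)
Lemma curv_gram X Y q : O q -> curv X Y q *m g q + g q *m (curv X Y q)^T = 0.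
Proof.
move=> Oq; rewrite -ricci_mx //; last exact: smooth_gram.
have D0 Z W : Dmx Z (Dmx W g) q = 0.
  rewrite {1}/Dmx Dmx_gram // mulmx0 mul0mx !subr0.
  by rewrite (@dmx_eq _ _ _ oO _ _ _ _ (fun=> 0)) ?dmx_cst // => z; exact: Dmx_gram.
by rewrite !D0 subrr.
Qed.

Lemma curv_antisym X Y q : curv Y X q = - curv X Y q.
Proof. by rewrite /curv; matrix_abelian. Qed.

Lemma dmx_conn_row X Y Z q : O q -> Z *m dmx X (conn Y) q = Y *m dmx X (conn Z) q.
Proof.
move=> Oq.
have E V V' : V *m dmx X (conn V') q = dmx X (fun z => V *m conn V' z) q.
  rewrite (dmxM (O := O)) ?dmx_cst ?mul0mx ?add0r //; first exact: smooth_mx_cst.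
  exact: smooth_conn.
by rewrite !E; apply: (dmx_eq oO) => // z Oz; exact: conn_sym.
Qed.

(** The terms cancel in pairs by torsion-freeness and its derivative, [conn_sym] and
    [dmx_conn_row]. *)
Lemma bianchi X Y Z q : O q ->
  Z *m curv X Y q + X *m curv Y Z q + Y *m curv Z X q = 0.
Proof.
move=> Oq; rewrite /curv !(mulmxBr, mulmxDr, mulmxA).
rewrite (dmx_conn_row Y X Z) // (dmx_conn_row X Y Z) // (dmx_conn_row Z X Y) //.
rewrite (conn_sym Z X) // (conn_sym Z Y) // (conn_sym Y X) //.
by matrix_abelian.
Qed.

Definition curv4 X Y Z W q : R := bil (g q) (Z *m curv X Y q) W.

Lemma curv4_skew12 X Y Z W q : curv4 X Y Z W q = - curv4 Y X Z W q.
Proof. by rewrite /curv4 /bil curv_antisym mulmxN !mulNmx [in LHS]mxE. Qed.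

Lemma curv4_skew34 X Y Z W q : O q -> curv4 X Y Z W q = - curv4 X Y W Z q.
Proof.
move=> Oq; apply/eqP; rewrite -addr_eq0; apply/eqP.
rewrite /curv4 (bil_sym (W *m _)) ?g_sym // /bil trmx_mul !mulmxA.
have := congr1 (fun B => (Z *m B *m W^T) 0 0) (curv_gram X Y Oq).
by rewrite mulmxDr mulmxDl mulmx0 mul0mx !mulmxA !mxE.
Qed.

Lemma curv4_bianchi X Y Z W q : O q ->
  curv4 X Y Z W q + curv4 Y Z X W q + curv4 Z X Y W q = 0.
Proof.
move=> Oq; have := congr1 (fun B => bil (g q) B W) (bianchi X Y Z Oq).
by rewrite /curv4 /bil !mulmxDl !mul0mx !mxE.
Qed.

(** The octahedron argument: the Bianchi identities of the four cyclic shifts of [X], [Y], [Z], [W],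
    combined linearly using the two skew-symmetries. *)
Lemma curv4_pair X Y Z W q : O q -> curv4 X Y Z W q = curv4 Z W X Y q.
Proof.
move=> Oq.
have := curv4_bianchi X Y Z W Oq; have := curv4_bianchi Y Z W X Oq.
have := curv4_bianchi Z W X Y Oq; have := curv4_bianchi W X Y Z Oq.
have s12 A B C D := curv4_skew12 A B C D q.
have s34 A B C D := curv4_skew34 A B C D Oq.
have := s34 Y Z W X; have := s34 Z W Y X; have := s34 W Y Z X.
have := s12 W Y X Z; have := s34 W X Z Y; have := s12 W X Y Z.
have := s34 X Z W Y; have := s12 Z X Y W; have := s34 X Y W Z.
lra.
Qed.

(** * The 1-form of the Killing field and its covariant derivative *)

Definition killing_form q : 'M[R]_n := cov_vec g xi q *m g q.
Definition killing_flat q : 'rV[R]_n := xi q *m g q.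
Local Notation U := killing_form.
Local Notation x := killing_flat.

Lemma cov_vecE X q : O q -> X *m cov_vec g xi q = dmx X xi q + xi q *m conn X q.
Proof.
move=> Oq; rewrite (dmx_dir _ smooth_field Oq); apply/rowP => k.
rewrite !mxE summxE.
under [X in _ = _ + X]eq_bigr do rewrite mxE mulr_sumr.
rewrite exchange_big -big_split; apply: eq_bigr => i _ /=.
rewrite !mxE partial_coord // mulrDr; congr (_ + _).
rewrite mulr_sumr; apply: eq_bigr => j _.
by rewrite [xi q 0 j * _]mulrC mulrA.
Qed.

Lemma smooth_cov_vec : smooth_mx O (cov_vec g xi).
Proof.
move=> i k; apply: (smooth_on_eq (U := O) (F := fun q => partial i xi q 0 k
  + \sum_j christoffel g k i j q * xi q 0 j)) => // [q _|]; first by rewrite mxE.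
apply: smooth_onD => //.
  by apply: smooth_on_coord => //; exact: smooth_on_partial.
apply: smooth_on_sum => // j; apply: smooth_onM => //.
  exact: smooth_christoffel.
exact: smooth_field.
Qed.

Lemma smooth_form : smooth_mx O U.
Proof.
apply: smooth_mxM => //; [exact: smooth_cov_vec|exact: smooth_gram].
Qed.

Lemma smooth_flat : smooth_mx O x.
Proof.
apply: smooth_mxM => //; [exact: smooth_field|exact: smooth_gram].
Qed.

Lemma Drow_flat X q : O q -> Drow X x q = X *m U q.
Proof.
move=> Oq; rewrite /Drow /U (dmxM (O := O)) //; first last.
- exact: smooth_gram.
- exact: smooth_field.
rewrite conn_metric // !mulmxA cov_vecE // mulmxDr mulmxDl !mulmxA.
by matrix_abelian.
Qed.

(** The symmetric part of nabla xi is half the Lie derivative of [g]: after exchanging arguments by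
    torsion-freeness, the connection terms add up to the derivative of [g] along xi. *)
Lemma form_skew q : O q -> (U q)^T = - U q.
Proof.
move=> Oq; apply/eqP; rewrite -addr_eq0 addrC; apply/eqP.
pose P : 'M[R]_n := \matrix_(i, k) dmx (basis_vec R i) xi q 0 k.
have -> : U q = (P + conn (xi q) q) *m g q.
  congr (_ *m _); apply/matrixP => i k.
  rewrite !mxE partial_coord //; congr (_ + _); apply: eq_bigr => j _.
  by rewrite mulrC (christoffel_sym _ _ _ Oq).
rewrite mulmxDl tr_add addrACA [(conn _ _ *m _)^T]trmx_mul g_sym // -conn_metric //.
rewrite -(xi_killing Oq); apply/matrixP => i j.
rewrite (dmx_dir _ smooth_gram Oq) !mxE summxE -!big_split.
apply: eq_bigr => k _ /=; rewrite !mxE !partial_coord //.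
have -> : g q k i = g q i k by rewrite -{1}(g_sym Oq) mxE.
by ring.
Qed.

Lemma Dmx_form_skew X q : O q -> (Dmx X U q)^T = - Dmx X U q.
Proof.
move=> Oq; rewrite /Dmx !(tr_add, tr_opp) (trmx_mul (conn X q)) (trmx_mul (U q)).
rewrite trmxK form_skew // -dmxT.
rewrite (dmx_eq oO _ _ (B := fun z => - U z)) //; last exact: form_skew.
rewrite (dmxN oO) //; last exact: smooth_form.
by rewrite mulmxN mulNmx; matrix_abelian.
Qed.

(** The Ricci identity for the 1-form [x], since nabla x = u; the terms caused by constant,
    non-parallel arguments cancel by torsion-freeness. *)
Lemma ricci_flat X Y q : O q ->
  Y *m Dmx X U q - X *m Dmx Y U q = x q *m (curv X Y q)^T.
Proof.
move=> Oq; rewrite -ricci_row //; last exact: smooth_flat.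
have D2 Z W : Drow Z (Drow W x) q = W *m Dmx Z U q + W *m conn Z q *m U q.
  rewrite {1}/Drow Drow_flat // (dmx_eq oO _ _ (B := fun z => W *m U z)) //; last first.
    by move=> z Oz; exact: Drow_flat.
  rewrite (dmxM (O := O)) // ?dmx_cst ?mul0mx ?add0r; first last.
  - exact: smooth_form.
  - exact: smooth_mx_cst.
  rewrite /Dmx !(mulmxBr, mulmxA); matrix_abelian.
by rewrite !D2 (conn_sym X Y) //; matrix_abelian.
Qed.

(* Kostant's identity: [A (X, Y, Z) = <(nabla_X u) Y, Z>] is skew in [Y, Z], and
   its skew part in [X, Y] is a curvature term, so that it is determined by the
   curvature, as in the proof of the uniqueness of the Levi-Civita connection. *)
Lemma kostant X Y Z q : O q ->
  let T X Y Z := (x q *m (curv X Y q)^T *m Z^T) 0 0 in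
  (Y *m Dmx X U q *m Z^T) 0 0 = 2^-1 * (T X Y Z + T Z X Y - T Y Z X).
Proof.
move=> Oq T.
pose A X Y Z := (Y *m Dmx X U q *m Z^T) 0 0.
have TA X' Y' Z' : T X' Y' Z' = A X' Y' Z' - A Y' X' Z'.
  by rewrite /T -ricci_flat // mulmxBl /A addmx_entry oppmx_entry.
have As X' Y' Z' : A X' Y' Z' = - A X' Z' Y'.
  rewrite /A -[in LHS](trmxK (Y' *m _ *m _)) mxE !trmx_mul trmxK.
  by rewrite Dmx_form_skew // mulNmx mulmxN mulmxA oppmx_entry.
rewrite !TA -/(A X Y Z).
have := As X Z Y; have := As Y Z X; have := As Z Y X.
by move: (A X Z Y) (A Y Z X) (A Z Y X) => a b c; lra.
Qed.

Lemma matrix_entry m k (B : 'M[R]_(m, k)) i j :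
  B i j = (delta_mx (0 : 'I_1) i *m B *m (delta_mx (0 : 'I_1) j)^T) 0 0.
Proof. by rewrite trmx_delta -rowE -colE !mxE. Qed.

(** By [kostant], nabla u is a contraction of [x] with the curvature, whose components are bounded
    near [p]. *)
Lemma Dmx_form_dominated D p m : O p -> (forall q, 0 <= m q) ->
  (forall j, dominated D p m (fun q => x q 0 j)) ->
  forall X i j, dominated D p m (fun q => Dmx X U q i j).
Proof.
move=> Op m0 xd X i j.
have Td X' Y' k : dominated D p m
    (fun q => (x q *m (curv X' Y' q)^T *m (basis_vec R k)^T) 0 0).
  apply: (@dominated_eq _ _ _ _ _ (fun q => \sum_l (curv X' Y' q k l) * x q 0 l)).
    apply: near_all => q _; rewrite trmx_delta -colE !mxE.
    by apply: eq_bigr => l _; rewrite mulrC [(_^T) _ _]mxE.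
  apply: dominated_sum => // l; apply: dominatedM => //.
  apply: continuous_dominated; exact: smooth_on_cont (smooth_curv X' Y' k l) Op.
apply: (@dominated_eq _ _ _ _ _ (fun q => 2^-1 *
   ((x q *m (curv X (basis_vec R i) q)^T *m (basis_vec R j)^T) 0 0
  + (x q *m (curv (basis_vec R j) X q)^T *m (basis_vec R i)^T) 0 0
  - (x q *m (curv (basis_vec R i) (basis_vec R j) q)^T *m X^T) 0 0))).
  by apply: near_open Op _ => // q Oq _; rewrite [RHS]matrix_entry kostant.
apply: dominatedM => //; first exact/continuous_dominated/cst_continuous.
apply: dominatedB; first by apply: dominatedD; exact: Td.
apply: (@dominated_eq _ _ _ _ _ (fun q => \sum_k X 0 k *
  (x q *m (curv (basis_vec R i) (basis_vec R j) q)^T *m (basis_vec R k)^T) 0 0)).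
  apply: near_all => q _; rewrite [RHS]mxE; apply: eq_bigr => k _.
  by rewrite trmx_delta -colE !mxE mulrC.
apply: dominated_sum => // k; apply: dominatedM => //.
exact/continuous_dominated/cst_continuous.
Qed.

Lemma dmx_flat X q : O q -> dmx X x q = X *m U q + x q *m (conn X q)^T.
Proof. by move=> Oq; rewrite -Drow_flat // /Drow subrK. Qed.

Lemma dmx_form X q : O q ->
  dmx X U q = Dmx X U q + conn X q *m U q + U q *m (conn X q)^T.
Proof. by move=> Oq; rewrite /Dmx; matrix_abelian. Qed.

Lemma partial_entry a b (B : 'rV[R]_n -> 'M[R]_(a, b)) i j k q :
  partial k (fun z => B z i j) q = dmx (basis_vec R k) B q i j.
Proof. by rewrite dmxE. Qed.

Lemma flat_eq0 q : O q -> x q = 0 -> xi q = 0.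
Proof.
by move=> Oq xq; rewrite -[xi q](mulmxK (gram_unit Oq)) -/(x q) xq mul0mx.
Qed.

Lemma killing_zero_propagates p : O p ->
  exists2 r, 0 < r & ball p r `<=` O /\
    forall q0 q1, ball p r q0 -> ball p r q1 ->
    xi q0 = 0 -> U q0 = 0 -> xi q1 = 0.
Proof.
move=> Op; pose F (b : 'I_n + 'I_n * 'I_n) q :=
  match b with inl j => x q 0 j | inr (i, j) => U q i j end.
pose m q := \sum_c `|F c q|.
have m0 q : 0 <= m q by exact: sumr_ge0.
have xd : dominated_mx setT p m x.
  by move=> i j; rewrite (ord1 i); exact: (dominated_term _ _ F (inl j)).
have Ud : dominated_mx setT p m U.
  by move=> i j; exact: (dominated_term _ _ F (inr (i, j))).
have cs := smooth_conn; have cT X : smooth_mx O (fun q => (conn X q)^T).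
  by apply: smooth_mxT => //; exact: cs.
(* [setT] replaces the dense set: this system holds on the whole chart, and it is the one from which
   density is deduced later. *)
have [|||r r0 [rO H]] := @zero_propagates _ _ _ O setT F p oO Op.
- by move=> q _; exact: subset_closure.
- by case=> [j|[i j]]; [exact: smooth_flat|exact: smooth_form].
- case=> [j|[i j]] k.
  + apply: (@dominated_eq _ _ _ _ _ (fun q => dmx (basis_vec R k) x q 0 j)).
      by apply: near_all => q _; rewrite -partial_entry.
    apply: (dominated_mx_eq oO Op (B := fun q => basis_vec R k *m U q
       + x q *m (conn (basis_vec R k) q)^T)) => [q Oq _|].
      by rewrite dmx_flat.
    apply: dominated_mxD.
      exact: (dominated_mxMl Op m0 (smooth_mx_cst O (basis_vec R k)) Ud).
    exact: (dominated_mxMr oO Op m0 (cT _) xd).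
  + apply: (@dominated_eq _ _ _ _ _ (fun q => dmx (basis_vec R k) U q i j)).
      by apply: near_all => q _; rewrite -partial_entry.
    apply: (dominated_mx_eq oO Op (B := fun q => Dmx (basis_vec R k) U q
      + conn (basis_vec R k) q *m U q + U q *m (conn (basis_vec R k) q)^T)) => [q Oq _|].
      by rewrite dmx_form.
    apply: dominated_mxD; first apply: dominated_mxD.
    - exact: Dmx_form_dominated.
    - exact: (dominated_mxMl Op m0 (cs _) Ud).
    - exact: (dominated_mxMr oO Op m0 (cT _) Ud).
exists r => //; split=> // q0 q1 B0 B1 xi0 U0.
apply: (flat_eq0 (rO _ B1)); apply/rowP => j; rewrite [RHS]mxE.
apply: (H q0 q1 B0 B1 _ (inl j)); case=> [l|[i l]] /=.
  by rewrite /x xi0 mul0mx mxE.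
by rewrite U0 mxE.
Qed.

(** * Contractions and the divergence of u *)

Lemma gram_entryC i j q : O q -> g q i j = g q j i.
Proof. by move=> Oq; rewrite -{1}(g_sym Oq) mxE. Qed.

Lemma invgram_entryC i j q : O q -> invmx (g q) i j = invmx (g q) j i.
Proof. by move=> Oq; rewrite -{1}(g_sym Oq) -trmx_inv mxE. Qed.

Lemma trace_gram q : O q -> \sum_i \sum_j invmx (g q) i j * g q i j = n%:R.
Proof.
move=> Oq; rewrite (eq_bigr (fun i => (invmx (g q) *m g q) i i)) => [|i _].
  by rewrite mulVmx ?gram_unit // (eq_bigr (fun=> 1)) ?sumr_const ?card_ord // => i _; rewrite mxE eqxx.
rewrite mxE; apply: eq_bigr => j _.
by rewrite gram_entryC.
Qed.

(* This is - (delta u) / (n - 1): it is smooth on the whole chart, and equal to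
   f times the 1-form [x] wherever f is defined. *)
Definition ddiv_form q : 'rV[R]_n := (n%:R - 1)^-1 *:
  \row_k \sum_i \sum_j invmx (g q) i j * Dmx (basis_vec R i) U q j k.
Local Notation sigma := ddiv_form.

Lemma smooth_ddiv : smooth_mx O sigma.
Proof.
apply: smooth_mxZ => //; first exact: smooth_on_cst.
move=> a k; apply: (smooth_on_eq (U := O) (F := fun q =>
   \sum_i \sum_j invmx (g q) i j * Dmx (basis_vec R i) U q j k)) => //.
  by move=> q _; rewrite mxE.
apply: smooth_on_sum => // i; apply: smooth_on_sum => // j.
apply: smooth_onM => //.
  by apply: smooth_invmx => //; [exact: gram_unit|exact: smooth_gram].
by apply: smooth_Dmx; exact: smooth_form.
Qed.

(** The matrix of the 2-form X /\ r, with [X] turned into a 1-form by the metric. *)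
Definition gram_wedge X (r : 'rV[R]_n) q : 'M[R]_n :=
  (X *m g q)^T *m r - r^T *m (X *m g q).

(** The first term of the wedge contributes the trace [n] of the metric, the second one contracts to
    [r] itself. *)
Lemma contract_wedge (r : 'rV[R]_n) q k : O q ->
  \sum_i \sum_j invmx (g q) i j * gram_wedge (basis_vec R i) r q j k
  = (n%:R - 1) * r 0 k.
Proof.
move=> Oq.
have gw i j : gram_wedge (basis_vec R i) r q j k = g q i j * r 0 k - r 0 j * g q i k.
  rewrite /gram_wedge -!rowE !mxE !big_ord1.
  by rewrite ![(_^T) _ _]mxE !mxE.
under eq_bigr => i _ do under eq_bigr => j _ do rewrite gw mulrBr mulrA.
under eq_bigr do rewrite sumrB -mulr_suml.
rewrite sumrB -mulr_suml trace_gram // mulrBl mul1r; congr (_ - _).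
rewrite exchange_big /= -[RHS](_ : \sum_j r 0 j * ((1%:M : 'M[R]_n) j k) = _); last first.
  rewrite (bigD1 k) //= big1 ?addr0 => [|j jk]; first by rewrite mxE eqxx mulr1.
  by rewrite mxE (negPf jk) mulr0.
apply: eq_bigr => j _; rewrite -(mulVmx (gram_unit Oq)) mxE mulr_sumr.
apply: eq_bigr => i _; rewrite mulrCA; congr (_ * (_ * _)).
by rewrite invgram_entryC.
Qed.

Lemma gram_wedge_sandwich X (r Z W q : 'rV[R]_n) :
  (Z *m gram_wedge X r q *m W^T) 0 0 =
  bil (g q) X Z * (r *m W^T) 0 0 - (r *m Z^T) 0 0 * bil (g q) X W.
Proof.
have tr1 (B : 'M[R]_1) : B^T = B by apply/matrixP => i j; rewrite mxE !ord1.
have E1 : Z *m (X *m g q)^T = X *m g q *m Z^T by rewrite -[RHS]tr1 [in RHS]trmx_mul trmxK.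
have E2 : Z *m r^T = r *m Z^T by rewrite -[RHS]tr1 trmx_mul trmxK.
have P (B C : 'M[R]_1) : (B *m C) 0 0 = B 0 0 * C 0 0 by rewrite mxE big_ord1.
rewrite /bil -!P -oppmx_entry -addmx_entry; congr (fun_of_matrix _ 0 0).
by rewrite /gram_wedge mulmxBr mulmxBl !mulmxA E1 E2.
Qed.

Lemma scalemx_entry a b (c : R) (B : 'M[R]_(a, b)) i j : (c *: B) i j = c * B i j.
Proof. by rewrite mxE. Qed.

Lemma gram_wedgeZ X (c : R) (r q : 'rV[R]_n) :
  gram_wedge X (c *: r) q = c *: gram_wedge X r q.
Proof. rewrite /gram_wedge; have -> : (c *: r)^T = c *: r^T by rewrite linearZ.
by rewrite -scalemxAr -scalemxAl scalerBr. Qed.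

(** * The equation nabla_X u = F X /\ xi on a dense open set *)

Section Twistor.
Variables (D : set 'rV[R]_n) (oD : open D) (DO : D `<=` O) (OD : O `<=` closure D).
Variable F : 'rV[R]_n -> R.
Hypothesis D_neq0 : forall q, D q -> xi q != 0.
Hypothesis Dform : forall q X, D q -> Dmx X U q = F q *: gram_wedge X (x q) q.
Hypothesis n_gt3 : (3 < n)%N.

Let nm1_neq0 : (n%:R - 1 : R) != 0.
Proof. by rewrite subr_eq0 pnatr_eq1 gtn_eqF // (ltn_trans _ n_gt3). Qed.

Lemma ddiv_flat q : D q -> sigma q = F q *: x q.
Proof.
move=> Dq; have Oq := DO Dq; apply: (scalerI nm1_neq0).
rewrite /sigma scalerA divff // scale1r; apply/rowP => k; rewrite mxE !scalemx_entry.
rewrite mulrCA -(contract_wedge (x q) k Oq) mulr_sumr; apply: eq_bigr => i _.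
rewrite mulr_sumr; apply: eq_bigr => j _.
by rewrite Dform // scalemx_entry mulrCA.
Qed.

Lemma flat_neq0 q : D q -> x q != 0.
Proof.
move=> Dq; apply: contraNneq (D_neq0 Dq) => xq; apply/eqP.
exact: flat_eq0 (DO Dq) xq.
Qed.

Lemma sum_sqr_gt0 (v : 'rV[R]_n) : v != 0 -> 0 < (v *m v^T) 0 0.
Proof.
move=> v0; rewrite mxE lt0r; apply/andP; split; last first.
  by apply: sumr_ge0 => j _; rewrite mxE -expr2 sqr_ge0.
apply: contraNneq v0 => E; apply/eqP/rowP => j; rewrite [RHS]mxE; apply/eqP.
have := @psumr_eq0P _ _ predT (fun j => v 0 j * v^T j 0).
move=> /(_ _ E j isT); rewrite mxE => H; rewrite -sqrf_eq0 expr2 H // => k _.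
by rewrite mxE -expr2 sqr_ge0.
Qed.

(** [F] is a priori an arbitrary function. It is recovered from [sigma = F x] as a quotient, using
    the Euclidean product of the coordinates, which is positive on [x]. *)
Lemma smooth_factor : smooth_on D F.
Proof.
have sx : smooth_mx D x by apply: smooth_mx_subset oD DO _; exact: smooth_flat.
have sr : smooth_mx D sigma by apply: smooth_mx_subset oD DO _; exact: smooth_ddiv.
have sxT := smooth_mxT oD sx.
apply: (smooth_on_eq (U := D)
  (F := fun q => (sigma q *m (x q)^T) 0 0 * ((x q *m (x q)^T) 0 0)^-1)) => //.
  move=> q Dq; rewrite ddiv_flat // -scalemxAl scalemx_entry mulfK //.
  by rewrite gt_eqF // sum_sqr_gt0 // flat_neq0.
apply: smooth_onM => //; first exact: (smooth_mxM oD sr sxT).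
apply: smooth_onV => // [q Dq|]; last exact: (smooth_mxM oD sx sxT).
by rewrite gt_eqF // sum_sqr_gt0 // flat_neq0.
Qed.

(* F is bounded near the zeros of [xi]: by Kostant's identity [F x = sigma] is a
   contraction of the curvature with [x]. *)
Lemma factor_dominated p : O p -> dominated D p (fun=> 1) F.
Proof.
move=> Op; pose m q := \sum_j `|x q 0 j|.
have m0 q : 0 <= m q by exact: sumr_ge0.
have xd j : dominated D p m (fun q => x q 0 j).
  exact: (dominated_term _ _ (fun j q => x q 0 j) j).
have sd : dominated_mx D p m sigma.
  apply: dominated_mxZ => //; first exact/continuous_dominated/cst_continuous.
  move=> a k; apply: (@dominated_eq _ _ _ _ _ (fun q =>
   \sum_i \sum_j invmx (g q) i j * Dmx (basis_vec R i) U q j k)).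
    by apply: near_all => q _; rewrite mxE.
  apply: dominated_sum => // i; apply: dominated_sum => // j.
  apply: dominatedM => //; last exact: Dmx_form_dominated.
  apply: (smooth_dominated _ Op); apply: smooth_invmx => //.
    exact: gram_unit.
  exact: smooth_gram.
have sd1 : dominated D p m (fun q => \sum_k `|sigma q 0 k|).
  by apply: dominated_sum => // k; apply: dominated_abs; exact: sd.
case: sd1 => C C0 hC; exists C => //.
apply: filterS hC => q H Dq; have := H Dq; rewrite mulr1.
have -> : \sum_k `|sigma q 0 k| = `|F q| * m q.
  rewrite mulr_sumr; apply: eq_bigr => k _.
  by rewrite ddiv_flat // scalemx_entry normrM.
have mq : 0 < m q.
  rewrite lt0r m0 andbT; apply: contraNneq (flat_neq0 Dq) => E; apply/eqP/rowP => j.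
  have := @psumr_eq0P _ _ predT (fun j => `|x q 0 j|).
  move=> /(_ _ E j isT) H1; rewrite [RHS]mxE; apply/eqP; rewrite -normr_eq0.
  by rewrite H1.
by rewrite normrM normr_id (ger0_norm (m0 q)) ler_pM2r.
Qed.

(** Written in terms of [sigma] rather than [F] and [x], to serve both for the rigidity argument and
    for the linear system satisfied by (u, sigma). *)
Lemma ricci_form X Y q : D q ->
  curv X Y q *m U q + U q *m (curv X Y q)^T =
  gram_wedge Y (Drow X sigma q) q - gram_wedge X (Drow Y sigma q) q.
Proof.
move=> Dq; have Oq := DO Dq.
rewrite -ricci_mx //; last exact: smooth_form.
have sg := smooth_gram; have ss := smooth_ddiv.
(* The last term arises because [W] is constant rather than parallel; it is symmetric in [Z] and [W]
   and leaves the commutator. *)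
have DD Z W : Dmx Z (Dmx W U) q =
    gram_wedge W (Drow Z sigma q) q + gram_wedge (W *m conn Z q) (sigma q) q.
  have E z : D z -> Dmx W U z = gram_wedge W (sigma z) z.
    by move=> Dz; rewrite Dform // ddiv_flat // gram_wedgeZ.
  rewrite {1}/Dmx E // (dmx_eq oD Z E Dq) /gram_wedge /Drow.
  have sW := smooth_mx_cst O W.
  rewrite !(dmxB oO, dmxM (O := O), dmxT, dmx_cst); try by smooth_tac.
  rewrite (conn_metric Z Oq).
  rewrite !(tr_add, tr_opp, trmx_mul, trmxK, g_sym Oq).
  rewrite !(mulmxBr, mulmxBl, mulmxDr, mulmxDl, mulmxN, mulNmx, mulmxA, opprD, opprB, mul0mx, mulmx0, trmx0).
  by matrix_abelian.
by rewrite !DD (conn_sym X Y Oq); matrix_abelian.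
Qed.

Lemma Drow_ddiv X q : D q -> Drow X sigma q = 'D_X F q *: x q + F q *: (X *m U q).
Proof.
move=> Dq; have Oq := DO Dq.
have E z : D z -> sigma z = F z *: x z by exact: ddiv_flat.
rewrite /Drow E // (dmx_eq oD X E Dq).
rewrite (dmxZ _ smooth_factor (smooth_mx_subset oD DO smooth_flat) Dq).
rewrite dmx_flat // scalerDr -scalemxAl.
by rewrite addrA addrK.
Qed.

Lemma sandwichD (B C : 'M[R]_n) Z W :
  (Z *m (B + C) *m W^T) 0 0 = (Z *m B *m W^T) 0 0 + (Z *m C *m W^T) 0 0.
Proof. by rewrite mulmxDr mulmxDl addmx_entry. Qed.

Lemma sandwichB (B C : 'M[R]_n) Z W :
  (Z *m (B - C) *m W^T) 0 0 = (Z *m B *m W^T) 0 0 - (Z *m C *m W^T) 0 0.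
Proof. by rewrite mulmxBr mulmxBl addmx_entry oppmx_entry. Qed.

Lemma skew_bil (V : 'M[R]_n) X W : V^T = - V ->
  (X *m V *m W^T) 0 0 = - (W *m V *m X^T) 0 0.
Proof.
move=> sV; rewrite -[in LHS](trmxK (X *m V *m W^T)) mxE !trmx_mul trmxK sV.
by rewrite mulNmx mulmxN mulmxA oppmx_entry.
Qed.

Lemma skew_bil_mul (V C : 'M[R]_n) Z W : V^T = - V ->
  (W *m (C *m V) *m Z^T) 0 0 = - (Z *m (V *m C^T) *m W^T) 0 0.
Proof.
move=> sV; rewrite -[in LHS](trmxK (W *m (C *m V) *m Z^T)) mxE !trmx_mul trmxK sV.
by rewrite !mulNmx mulmxN oppmx_entry !mulmxA.
Qed.

(** [twistor_rigidity] for the actual curvature: [e] is the 1-form of u xi, and [c] is the inverse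
    of the squared length of xi. *)
Lemma form_rank_two q : D q -> (exists X, 'D_X F q != 0) ->
  U q != 0 /\ exists e : 'rV[R]_n, exists c : R,
    forall i j, U q i j = c * (x q 0 i * e 0 j - e 0 i * x q 0 j).
Proof.
move=> Dq [X0 dF]; have Oq := DO Dq.
have DF X : 'D_X F q = (X *m (\col_i partial i F q)) 0 0.
  rewrite (derive_dir _ (smooth_on_diff smooth_factor Dq)) mxE.
  by apply: eq_bigr => i _; rewrite mxE.
pose A := cov_vec g xi q.
have UA X Y : bil (g q) (X *m A) Y = (X *m U q *m Y^T) 0 0.
  by rewrite /bil /U !mulmxA.
have xb Z : (x q *m Z^T) 0 0 = bil (g q) Z (xi q).
  by rewrite (bil_sym _ _ (g_sym Oq)).
have bU X W : (X *m U q *m W^T) 0 0 = - (W *m U q *m X^T) 0 0.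
  by apply: skew_bil; exact: form_skew.
have K34 X Y Z W : curv4 X Y Z (W *m A) q = - (Z *m (curv X Y q *m U q) *m W^T) 0 0.
  rewrite /curv4 /bil trmx_mul !mulmxA -[Z *m _ *m _ *m A^T]mulmxA.
  have -> : g q *m A^T = (U q)^T by rewrite trmx_mul g_sym.
  by rewrite form_skew // mulmxN mulNmx oppmx_entry !mulmxA.
have [||||||||E0 H] := @twistor_rigidity R n (g q) A (xi q) (\col_i partial i F q)
    (F q) (fun X Y Z W => curv4 X Y Z W q) n_gt3 (g_sym Oq) (g_pos Oq).
- by move=> X Y; rewrite !UA bU.
- by move=> X Y Z W; exact: curv4_skew34.
- by move=> X Y Z W; exact: curv4_pair.
- move=> X Y Z.
  have -> : curv4 X Y Z (xi q) q = (x q *m (curv X Y q)^T *m Z^T) 0 0.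
    by rewrite /curv4 (bil_sym _ _ (g_sym Oq)) /bil trmx_mul !mulmxA.
  rewrite -ricci_flat // !Dform // mulmxBl addmx_entry oppmx_entry.
  rewrite -!scalemxAr -!scalemxAl !scalemx_entry !gram_wedge_sandwich !xb.
  rewrite (bil_sym Y X (g_sym Oq)); ring.
- by move=> X Y W; rewrite /curv4 /bil !mul0mx mxE.
- move=> X Y Z W; rewrite -!DF.
  have -> : curv4 X Y (Z *m A) W q = (Z *m (U q *m (curv X Y q)^T) *m W^T) 0 0 * -1.
    rewrite curv4_skew34 // K34 opprK.
    by rewrite skew_bil_mul ?form_skew //; ring.
  have DrowE V V' : (Drow V sigma q *m V'^T) 0 0 =
      'D_V F q * bil (g q) V' (xi q) + F q * bil (g q) (V *m A) V'.
    by rewrite Drow_ddiv // mulmxDl -!scalemxAl addmx_entry !scalemx_entry xb -UA.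
  rewrite K34; have HH := congr1 (fun B => (Z *m B *m W^T) 0 0) (ricci_form X Y Dq).
  rewrite /= sandwichD sandwichB !gram_wedge_sandwich !DrowE in HH.
  by rewrite mulrN1 -opprD opprK HH; ring.
- by exists X0; rewrite -DF.
- exact: D_neq0.
have xe i : x q 0 i = bil (g q) (basis_vec R i) (xi q).
  by rewrite -xb trmx_delta -colE [RHS]mxE.
split.
  (* [E0] says that u takes a positive value on xi and u xi. *)
  apply: contraTneq E0 => U0.
  by rewrite UA U0 mulmx0 mul0mx mxE ltxx.
exists (\row_j bil (g q) (basis_vec R j) (xi q *m A)).
exists (bil (g q) (xi q) (xi q))^-1 => i j.
have N0 : bil (g q) (xi q) (xi q) != 0 by rewrite gt_eqF // g_pos // D_neq0.
apply: (mulfI N0); rewrite mulVKf // !xe ![(\row_j _) 0 _]mxE -H UA.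
by congr (_ * _); rewrite [LHS]matrix_entry.
Qed.

Lemma gram_wedge_dominated p m X (r : 'rV[R]_n -> 'rV[R]_n) : O p ->
  (forall q, 0 <= m q) -> dominated_mx D p m r ->
  dominated_mx D p m (fun q => gram_wedge X (r q) q).
Proof.
move=> Op m0 dr; have sg : smooth_mx O (fun q => X *m g q).
  by apply: smooth_mxM => //; [exact: smooth_mx_cst|exact: smooth_gram].
apply: dominated_mxD.
  exact: (dominated_mxMl Op m0 (smooth_mxT oO sg) dr).
apply: dominated_mxN.
exact: (dominated_mxMr oO Op m0 sg (dominated_mxT dr)).
Qed.

Lemma dominated_partial a b p m (B C : 'rV[R]_n -> 'M[R]_(a, b)) i j k : O p ->
  (forall q, D q -> dmx (basis_vec R k) B q = C q) -> dominated_mx D p m C ->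
  dominated D p m (partial k (fun q => B q i j)).
Proof.
move=> Op BC dC; apply: (@dominated_eq _ _ _ _ _ (fun q => C q i j)); last exact: dC.
by apply: near_all => q Dq; rewrite partial_entry BC.
Qed.

Lemma smooth_conn_tr X : smooth_mx O (fun q => (conn X q)^T).
Proof. by apply: smooth_mxT => //; exact: smooth_conn. Qed.

(* The form [rho = sigma - c x] is [(F - c) x] on [D], where its covariant derivative
   [kap] is [(F - c) U] because [dF = 0]; hence [rho] and [kap] satisfy a linear
   system with bounded coefficients. *)
Lemma constant_factor_propagates (c : R) p : O p ->
  (forall q X, D q -> 'D_X F q = 0) ->
  exists2 r, 0 < r & ball p r `<=` O /\
    forall q0 q1, ball p r q0 -> ball p r q1 -> D q0 -> D q1 ->
    F q0 = c -> F q1 = c.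
Proof.
move=> Op dF.
pose rho q := sigma q - c *: x q.
(* Introduced as the covariant derivative of [rho], and not as [(F - c) U], in order to be smooth on
   all of [O]. *)
pose kap q := \matrix_(i, j) Drow (basis_vec R i) rho q 0 j.
have kapE i j q : kap q i j = Drow (basis_vec R i) rho q 0 j by rewrite [LHS]mxE.
have scx : smooth_mx O (fun q => c *: x q).
  by apply: smooth_mxZ => //; [exact: smooth_on_cst|exact: smooth_flat].
have srho : smooth_mx O rho by apply: smooth_mxB => //; exact: smooth_ddiv.
have skap : smooth_mx O kap.
  move=> i j; apply: (smooth_on_eq (U := O)
    (F := fun q => Drow (basis_vec R i) rho q 0 j)) => //.
  exact: smooth_Drow.
have rhoD q : D q -> rho q = (F q - c) *: x q.
  by move=> Dq; rewrite /rho ddiv_flat // scalerBl.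
have kapD q : D q -> kap q = (F q - c) *: U q.
  move=> Dq; have Oq := DO Dq; apply/matrixP => i j; rewrite kapE [RHS]scalemx_entry.
  have -> : Drow (basis_vec R i) rho q = Drow (basis_vec R i) sigma q - c *: Drow (basis_vec R i) x q.
    rewrite /Drow /rho (dmxB oO) //; last exact: smooth_ddiv.
    rewrite (dmxZ _ (smooth_on_cst _ _) smooth_flat Oq) derive_cst scale0r add0r.
    rewrite [(sigma q - _) *m _]mulmxBl -[(c *: x q) *m _]scalemxAl [c *: (_ - _)]scalerBr.
    by matrix_abelian.
  rewrite Drow_ddiv // dF // scale0r add0r Drow_flat // -scalerBl.
  by rewrite -rowE scalemx_entry [row _ _ _ _]mxE.
pose Fn (b : 'I_n + 'I_n * 'I_n) q :=
  match b with inl j => rho q 0 j | inr (i, j) => kap q i j end.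
pose m q := \sum_c `|Fn c q|.
have m0 q : 0 <= m q by exact: sumr_ge0.
have rhod : dominated_mx D p m rho.
  by move=> i j; rewrite (ord1 i); exact: (dominated_term _ _ Fn (inl j)).
have kapd : dominated_mx D p m kap.
  by move=> i j; exact: (dominated_term _ _ Fn (inr (i, j))).
have [||r r0 [rO H]] := @zero_propagates _ _ _ O D Fn p oO Op OD.
- by case=> [j|[i j]]; [exact: srho|exact: skap].
- case=> [j|[i j]] k.
  + apply: (@dominated_partial _ _ _ _ rho (fun q => basis_vec R k *m kap q
       + rho q *m (conn (basis_vec R k) q)^T)) => //.
      move=> q Dq; rewrite -rowE.
      have -> : row k (kap q) = Drow (basis_vec R k) rho q.
        by apply/rowP => l; rewrite [LHS]mxE kapE.
      by rewrite /Drow subrK.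
    apply: dominated_mxD.
      exact: (dominated_mxMl Op m0 (smooth_mx_cst O (basis_vec R k)) kapd).
    exact: (dominated_mxMr oO Op m0 (smooth_conn_tr _) rhod).
  + apply: (@dominated_partial _ _ _ _ kap (fun q =>
      F q *: gram_wedge (basis_vec R k) (rho q) q
      + conn (basis_vec R k) q *m kap q + kap q *m (conn (basis_vec R k) q)^T)) => //.
      move=> q Dq; have Oq := DO Dq.
      have sFc : smooth_on D (fun z => F z - c).
        by apply: smooth_onB => //; [exact: smooth_factor|exact: smooth_on_cst].
      rewrite (dmx_eq oD _ kapD Dq) (dmxZ _ sFc (smooth_mx_subset oD DO smooth_form) Dq).
      have -> : 'D_(basis_vec R k) (fun z => F z - c) q = 0.
        rewrite deriveB ?derive_cst ?dF ?subr0 //.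
        exact/diff_derivable/(smooth_on_diff smooth_factor Dq).
      rewrite scale0r add0r dmx_form // kapD // rhoD // Dform // gram_wedgeZ.
      by rewrite -scalemxAr -scalemxAl !scalerDr !scalerA [_ * F q]mulrC.
    apply: dominated_mxD; first apply: dominated_mxD.
    - apply: (dominated_mxZ m0 (factor_dominated Op)).
      exact: gram_wedge_dominated.
    - exact: (dominated_mxMl Op m0 (smooth_conn _) kapd).
    - exact: (dominated_mxMr oO Op m0 (smooth_conn_tr _) kapd).
exists r => //; split=> // q0 q1 B0 B1 D0 D1 F0.
have Fc0 : F q0 - c = 0 by rewrite F0 subrr.
have rho1 : rho q1 = 0.
  apply/rowP => j; rewrite [RHS]mxE; apply: (H q0 q1 B0 B1 _ (inl j)).
  case=> [l|[i l]] /=; first by rewrite rhoD // Fc0 scale0r mxE.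
  by rewrite kapD // Fc0 scale0r mxE.
move: rho1; rewrite rhoD // => /eqP; rewrite scaler_eq0 (negPf (flat_neq0 D1)) orbF.
by rewrite subr_eq0 => /eqP.
Qed.

(* [U] and [sigma] satisfy a linear system: nabla_X u = X /\ sigma, and the Ricci
   identity for [U], contracted twice, expresses nabla sigma linearly in [U]. *)
Lemma zero_form_propagates p : O p ->
  exists2 r, 0 < r & ball p r `<=` O /\
    forall q0 q1, ball p r q0 -> ball p r q1 -> D q0 ->
    U q0 = 0 -> F q0 = 0 -> U q1 = 0.
Proof.
move=> Op.
pose Fn (b : 'I_n + 'I_n * 'I_n) q :=
  match b with inl j => sigma q 0 j | inr (i, j) => U q i j end.
pose m q := \sum_c `|Fn c q|.
have m0 q : 0 <= m q by exact: sumr_ge0.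
have sd : dominated_mx D p m sigma.
  by move=> i j; rewrite (ord1 i); exact: (dominated_term _ _ Fn (inl j)).
have Ud : dominated_mx D p m U.
  by move=> i j; exact: (dominated_term _ _ Fn (inr (i, j))).
have ginvd i j : dominated D p (fun=> 1) (fun q => invmx (g q) i j).
  apply: (smooth_dominated _ Op); apply: smooth_invmx => //.
    exact: gram_unit.
  exact: smooth_gram.
pose Ric l i q := curv (basis_vec R l) (basis_vec R i) q *m U q
   + U q *m (curv (basis_vec R l) (basis_vec R i) q)^T.
have Ricd l i : dominated_mx D p m (Ric l i).
  apply: dominated_mxD; first exact: (dominated_mxMl Op m0 (smooth_curv _ _) Ud).
  apply: (dominated_mxMr oO Op m0 _ Ud); apply: smooth_mxT => //; exact: smooth_curv.
pose S l k q := Drow (basis_vec R l) sigma q 0 k.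
pose tr q := \sum_l \sum_k invmx (g q) l k * S l k q.
pose r1 l k q := \sum_i \sum_j invmx (g q) i j * Ric l i q j k.
have r1d l k : dominated D p m (r1 l k).
  apply: dominated_sum => // i; apply: dominated_sum => // j.
  by apply: dominatedM => //; exact: Ricd.
(* Contract [ricci_form]: the first wedge gives [(n - 1) S], the second [S - tr g]. Contracting
   again gives [(n - 2) tr + n tr = 2 (n - 1) tr], so that [tr], and then [S], are linear in [U]. *)
have r1E l k q : D q -> r1 l k q = (n%:R - 2) * S l k q + tr q * g q l k.
  move=> Dq; have Oq := DO Dq.
  have -> : r1 l k q = (n%:R - 1) * S l k q - (S l k q - tr q * g q l k).
    rewrite -(contract_wedge (Drow (basis_vec R l) sigma q) k Oq) /r1.
    under eq_bigr => i _ do under eq_bigr => j _ do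
      rewrite /Ric ricci_form // addmx_entry oppmx_entry mulrBr.
    under eq_bigr do rewrite sumrB.
    rewrite sumrB; congr (_ - _).
    have gw i j : gram_wedge (basis_vec R l) (Drow (basis_vec R i) sigma q) q j k
        = g q l j * S i k q - S i j q * g q l k.
      rewrite /gram_wedge -rowE addmx_entry oppmx_entry; congr (_ - _).
        by rewrite mxE big_ord1 [(_^T) _ _]mxE [(row _ _) _ _]mxE.
      by rewrite mxE big_ord1 [(_^T) _ _]mxE [(row _ _) _ _]mxE.
    under eq_bigr => i _ do under eq_bigr => j _ do rewrite gw mulrBr !mulrA.
    under eq_bigr do rewrite sumrB -!mulr_suml.
    rewrite sumrB -mulr_suml; congr (_ - _).
    have inner i : \sum_j invmx (g q) i j * g q l j = (i == l)%:R.
      have -> : (i == l)%:R = (invmx (g q) *m g q) i l :> R.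
        by rewrite mulVmx ?gram_unit // mxE.
      by rewrite mxE; apply: eq_bigr => j _; rewrite [g q l j]gram_entryC.
    under eq_bigr do rewrite inner.
    rewrite (bigD1 l) //= eqxx mul1r big1 ?addr0 // => i il.
    by rewrite (negPf il) mul0r.
  by ring.
have n2 : (n%:R - 2 : R) != 0.
  by rewrite subr_eq0 eqr_nat gtn_eqF // (ltn_trans _ n_gt3).
have trd : dominated D p m tr.
  apply: (@dominated_eq _ _ _ _ _ (fun q => (2 * (n%:R - 1))^-1 *
     \sum_l \sum_k invmx (g q) l k * r1 l k q)).
    apply: near_all => q Dq; have Oq := DO Dq.
    have -> : \sum_l \sum_k invmx (g q) l k * r1 l k q = 2 * (n%:R - 1) * tr q.
      under eq_bigr => l _ do under eq_bigr => k _ do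
        rewrite r1E // mulrDr mulrCA [X in _ + X]mulrCA.
      under eq_bigr do rewrite big_split /= -!mulr_sumr.
      by rewrite big_split /= -!mulr_sumr trace_gram // -/(tr q); ring.
    by rewrite mulKf // mulf_neq0 // pnatr_eq0.
  apply: dominatedM => //; first exact/continuous_dominated/cst_continuous.
  apply: dominated_sum => // l; apply: dominated_sum => // k.
  exact: dominatedM.
have Sd l k : dominated D p m (S l k).
  apply: (@dominated_eq _ _ _ _ _ (fun q => (n%:R - 2)^-1 * (r1 l k q - g q l k * tr q))).
    apply: near_all => q Dq; rewrite r1E // [g q l k * _]mulrC addrK mulKf //.
  apply: dominatedM => //; first exact/continuous_dominated/cst_continuous.
  apply: dominatedB => //; apply: dominatedM => //.
  by apply: (smooth_dominated _ Op); exact: smooth_gram.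
have [||r r0 [rO H]] := @zero_propagates _ _ _ O D Fn p oO Op OD.
- by case=> [j|[i j]]; [exact: smooth_ddiv|exact: smooth_form].
- case=> [j|[i j]] k.
  + apply: (@dominated_partial _ _ _ _ sigma (fun q => Drow (basis_vec R k) sigma q
       + sigma q *m (conn (basis_vec R k) q)^T)) => //.
      by move=> q Dq; rewrite /Drow subrK.
    apply: dominated_mxD; first by move=> a l; rewrite (ord1 a); exact: Sd.
    exact: (dominated_mxMr oO Op m0 (smooth_conn_tr _) sd).
  + apply: (@dominated_partial _ _ _ _ U (fun q => gram_wedge (basis_vec R k) (sigma q) q
      + conn (basis_vec R k) q *m U q + U q *m (conn (basis_vec R k) q)^T)) => //.
      by move=> q Dq; rewrite dmx_form ?Dform ?ddiv_flat ?gram_wedgeZ //; exact: DO.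
    apply: dominated_mxD; first apply: dominated_mxD.
    - exact: gram_wedge_dominated.
    - exact: (dominated_mxMl Op m0 (smooth_conn _) Ud).
    - exact: (dominated_mxMr oO Op m0 (smooth_conn_tr _) Ud).
exists r => //; split=> // q0 q1 B0 B1 D0 U0 F0.
apply/matrixP => i j; rewrite [RHS]mxE; apply: (H q0 q1 B0 B1 _ (inr (i, j))).
case=> [l|[a l]] /=; first by rewrite ddiv_flat // F0 scale0r mxE.
by rewrite U0 mxE.
Qed.

Definition flat_wedge_form i j k q : R :=
  x q 0 i * U q j k - x q 0 j * U q i k + x q 0 k * U q i j.

(** Half the component of u /\ u, that is, the Pfaffian of the 4 by 4 block of [U] on these
    indices. *)
Definition form_square i j k l q : R :=
  U q i j * U q k l - U q i k * U q j l + U q i l * U q j k.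

Local Notation om := flat_wedge_form.
Local Notation nu := form_square.

(* nabla_X (xi /\ u) is half the contraction of [X] with u /\ u, and
   nabla_X (u /\ u) = 2 F X /\ xi /\ u. *)
Lemma flat_wedge_propagates p : O p ->
  exists2 r, 0 < r & ball p r `<=` O /\
    forall q0 q1, ball p r q0 -> ball p r q1 ->
    (forall i j k, om i j k q0 = 0) -> (forall i j k l, nu i j k l q0 = 0) ->
    (forall i j k, om i j k q1 = 0) /\ (forall i j k l, nu i j k l q1 = 0).
Proof.
move=> Op.
pose Fn (b : 'I_n * 'I_n * 'I_n + 'I_n * 'I_n * 'I_n * 'I_n) q :=
  match b with inl (i, j, k) => om i j k q | inr (i, j, k, l) => nu i j k l q end.
pose m q := \sum_c `|Fn c q|.
have m0 q : 0 <= m q by exact: sumr_ge0.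
have omd i j k : dominated D p m (om i j k) by exact: (dominated_term _ _ Fn (inl (i, j, k))).
have nud i j k l : dominated D p m (nu i j k l).
  exact: (dominated_term _ _ Fn (inr (i, j, k, l))).
have sx i : smooth_on O (fun q => x q 0 i) by exact: smooth_flat.
have sU i j : smooth_on O (fun q => U q i j) by exact: smooth_form.
have som i j k : smooth_on O (om i j k).
  apply: smooth_onD => //; last exact: smooth_onM.
  by apply: smooth_onB => //; exact: smooth_onM.
have snu i j k l : smooth_on O (nu i j k l).
  apply: smooth_onD => //; last exact: smooth_onM.
  by apply: smooth_onB => //; exact: smooth_onM.
pose C h i l q := conn (basis_vec R h) q i l.
have Cd h i l : dominated D p (fun=> 1) (C h i l).
  by apply: (smooth_dominated _ Op); exact: smooth_conn.
have gd i j : dominated D p (fun=> 1) (fun q => g q i j).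
  by apply: (smooth_dominated _ Op); exact: smooth_gram.
pose cx h i q := \sum_l C h i l q * x q 0 l.
pose cU h i k q := \sum_l C h i l q * U q l k.
pose Uc h i k q := \sum_l C h k l q * U q i l.
have dx h i q : D q -> is_derive q (basis_vec R h) (fun z => x z 0 i) (U q h i + cx h i q).
  move=> Dq; have Oq := DO Dq; apply: DeriveDef.
    exact/diff_derivable/(smooth_on_diff (sx i) Oq).
  rewrite -dmxE dmx_flat // -rowE addmx_entry [row _ _ _ _]mxE; congr (_ + _).
  rewrite mxE; apply: eq_bigr => l _; rewrite [(_^T) _ _]mxE.
  by rewrite mulrC.
have dU h i j q : D q -> is_derive q (basis_vec R h) (fun z => U z i j)
   (F q * (g q h i * x q 0 j - x q 0 i * g q h j) + cU h i j q + Uc h i j q).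
  move=> Dq; have Oq := DO Dq; apply: DeriveDef.
    exact/diff_derivable/(smooth_on_diff (sU i j) Oq).
  rewrite -dmxE dmx_form // Dform // 2!addmx_entry; congr (_ + _ + _).
  - rewrite scalemx_entry; congr (_ * _).
    rewrite /gram_wedge -rowE addmx_entry oppmx_entry; congr (_ - _).
      by rewrite mxE big_ord1 [(_^T) _ _]mxE [(row _ _) _ _]mxE.
    by rewrite mxE big_ord1 [(_^T) _ _]mxE [(row _ _) _ _]mxE.
  - by rewrite mxE.
  - rewrite mxE; apply: eq_bigr => l _; rewrite [(_^T) _ _]mxE.
    by rewrite mulrC.
(* In [dom] and [dnu] the covariant derivative comes first, then one connection term for each
   index. *)
pose dom h i j k q := nu h i j k q + (\sum_l C h i l q * om l j k q
  + \sum_l C h j l q * om i l k q + \sum_l C h k l q * om i j l q).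
pose dnu h i j k l q := F q * (g q h i * om j k l q - g q h j * om i k l q
    + g q h k * om i j l q - g q h l * om i j k q)
  + (\sum_s C h i s q * nu s j k l q + \sum_s C h j s q * nu i s k l q
  + \sum_s C h k s q * nu i j s l q + \sum_s C h l s q * nu i j k s q).
have domE h i j k q : D q -> partial h (om i j k) q = dom h i j k q.
  move=> Dq; rewrite /partial.
  have H := is_deriveD (is_deriveB (is_deriveM (dx h i q Dq) (dU h j k q Dq))
    (is_deriveM (dx h j q Dq) (dU h i k q Dq))) (is_deriveM (dx h k q Dq) (dU h i j q Dq)).
  have -> : om i j k = (fun z => x z 0 i) * (fun z => U z j k) -
     (fun z => x z 0 j) * (fun z => U z i k) + (fun z => x z 0 k) * (fun z => U z i j) by [].
  rewrite (@derive_val _ _ _ _ _ _ _ H) /GRing.scale /=.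
  have e1 : \sum_l C h i l q * om l j k q =
      U q j k * cx h i q - x q 0 j * cU h i k q + x q 0 k * cU h i j q.
    rewrite /cx /cU -sum_lin3; apply: eq_bigr => l _; congr (_ * _).
    by rewrite /flat_wedge_form [x q 0 l * _]mulrC.
  have e2 : \sum_l C h j l q * om i l k q =
      x q 0 i * cU h j k q - U q i k * cx h j q + x q 0 k * Uc h i j q.
    rewrite /cx /cU /Uc -sum_lin3; apply: eq_bigr => l _; congr (_ * _).
    by rewrite /flat_wedge_form [x q 0 l * _]mulrC.
  have e3 : \sum_l C h k l q * om i j l q =
      x q 0 i * Uc h j k q - x q 0 j * Uc h i k q + U q i j * cx h k q.
    rewrite /cx /Uc -sum_lin3; apply: eq_bigr => l _; congr (_ * _).
    by rewrite /flat_wedge_form [x q 0 l * _]mulrC.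
  rewrite /dom e1 e2 e3 /form_square; ring.
have dnuE h i j k l q : D q -> partial h (nu i j k l) q = dnu h i j k l q.
  move=> Dq; rewrite /partial.
  have H := is_deriveD (is_deriveB (is_deriveM (dU h i j q Dq) (dU h k l q Dq))
    (is_deriveM (dU h i k q Dq) (dU h j l q Dq)))
    (is_deriveM (dU h i l q Dq) (dU h j k q Dq)).
  have -> : nu i j k l = (fun z => U z i j) * (fun z => U z k l) -
     (fun z => U z i k) * (fun z => U z j l) + (fun z => U z i l) * (fun z => U z j k) by [].
  rewrite (@derive_val _ _ _ _ _ _ _ H) /GRing.scale /=.
  have e1 : \sum_s C h i s q * nu s j k l q =
      U q k l * cU h i j q - U q j l * cU h i k q + U q j k * cU h i l q.
    rewrite /cU -sum_lin3; apply: eq_bigr => s _; congr (_ * _).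
    by rewrite /form_square; ring.
  have e2 : \sum_s C h j s q * nu i s k l q =
      U q k l * Uc h i j q - U q i k * cU h j l q + U q i l * cU h j k q.
    rewrite /cU /Uc -sum_lin3; apply: eq_bigr => s _; congr (_ * _).
    by rewrite /form_square; ring.
  have e3 : \sum_s C h k s q * nu i j s l q =
      U q i j * cU h k l q - U q j l * Uc h i k q + U q i l * Uc h j k q.
    rewrite /cU /Uc -sum_lin3; apply: eq_bigr => s _; congr (_ * _).
    by rewrite /form_square; ring.
  have e4 : \sum_s C h l s q * nu i j k s q =
      U q i j * Uc h k l q - U q i k * Uc h j l q + U q j k * Uc h i l q.
    rewrite /Uc -sum_lin3; apply: eq_bigr => s _; congr (_ * _).
    by rewrite /form_square; ring.
  rewrite /dnu e1 e2 e3 e4 /flat_wedge_form; ring.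
have Fd := factor_dominated Op.
have [||r r0 [rO H]] := @zero_propagates _ _ _ O D Fn p oO Op OD.
- by case=> [[[i j] k]|[[[i j] k] l]]; [exact: som|exact: snu].
- case=> [[[i j] k]|[[[i j] k] l]] h.
  + apply: (@dominated_eq _ _ _ _ _ (dom h i j k)).
      by apply: near_all => q Dq; rewrite /= domE.
    apply: dominatedD => //.
    by apply: dominatedD; first apply: dominatedD;
      apply: dominated_sum => // s; exact: dominatedM.
  + apply: (@dominated_eq _ _ _ _ _ (dnu h i j k l)).
      by apply: near_all => q Dq; rewrite /= dnuE.
    apply: dominatedD; first apply: dominatedM => //.
      apply: dominatedB; last exact: dominatedM.
      apply: dominatedD; last exact: dominatedM.
      by apply: dominatedB; exact: dominatedM.
    by apply: dominatedD; first apply: dominatedD; first apply: dominatedD;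
      apply: dominated_sum => // s; exact: dominatedM.
exists r => //; split=> // q0 q1 B0 B1 om0 nu0.
have Z : forall b, Fn b q1 = 0.
  by apply: (H q0 q1 B0 B1); case=> [[[i j] k]|[[[i j] k] l]]; [exact: om0|exact: nu0].
split=> [i j k|i j k l]; first exact: (Z (inl (i, j, k))).
exact: (Z (inr (i, j, k, l))).
Qed.

(** If u vanishes near [q], so does nabla u at [q], and with it [sigma = F x]. This supplies the
    second initial condition of [zero_form_propagates]. *)
Lemma factor_eq0 q : D q -> (\forall z \near q, U z = 0) -> F q = 0.
Proof.
move=> Dq U0; have Oq := DO Dq.
have DU0 X : Dmx X U q = 0.
  rewrite /Dmx (nbhs_singleton U0) mulmx0 mul0mx !subr0.
  apply/matrixP => i j; rewrite dmxE [RHS]mxE -(derive_cst (0 : R) q X).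
  by apply: near_eq_derive; apply: filterS U0 => z ->; rewrite mxE.
have : F q *: x q = 0.
  rewrite -ddiv_flat // /sigma (_ : \row_k _ = 0) ?scaler0 //.
  apply/rowP => k; rewrite !mxE big1 // => i _; rewrite big1 // => j _.
  by rewrite DU0 mxE mulr0.
by move/eqP; rewrite scaler_eq0 (negPf (flat_neq0 Dq)) orbF => /eqP.
Qed.

End Twistor.

(** * Index formulas for u and its covariant derivative *)

Lemma form_curl i j q : O q ->
  'D_(basis_vec R i) (fun z => x z 0 j) q - 'D_(basis_vec R j) (fun z => x z 0 i) q
  = 2 * U q i j.
Proof.
move=> Oq; rewrite -!dmxE !dmx_flat // -!rowE !addmx_entry ![row _ _ _ _]mxE.
have -> : (x q *m (conn (basis_vec R i) q)^T) 0 j = (x q *m (conn (basis_vec R j) q)^T) 0 i.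
  rewrite ![(x q *m _) _ _]mxE; apply: eq_bigr => l _; rewrite ![(_^T) _ _]mxE.
  have /rowP/(_ l) := conn_sym (basis_vec R i) (basis_vec R j) Oq.
  by rewrite -!rowE ![row _ _ _ _]mxE => ->.
have -> : U q j i = - U q i j.
  by have /matrixP/(_ i j) := form_skew Oq; rewrite [LHS]mxE oppmx_entry.
by ring.
Qed.

Lemma cov_deriv_form X (I : 'I_2 -> 'I_n) q : O q ->
  cov_deriv g (cov_form g xi) q X I = Dmx X U q (I ord0) (I ord_max).
Proof.
move=> Oq; rewrite /Dmx 2!addmx_entry 2!oppmx_entry.
rewrite (dmx_dir _ smooth_form Oq) summxE.
have -> : (conn X q *m U q) (I ord0) (I ord_max) =
    \sum_k X 0 k * \sum_l christoffel g l k (I ord0) q * U q l (I ord_max).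
  rewrite mxE; under eq_bigr do rewrite [conn _ _ _ _]mxE mulr_suml.
  rewrite exchange_big; apply: eq_bigr => k _; rewrite mulr_sumr.
  by apply: eq_bigr => l _; rewrite mulrA.
have -> : (U q *m (conn X q)^T) (I ord0) (I ord_max) =
    \sum_k X 0 k * \sum_l christoffel g l k (I ord_max) q * U q (I ord0) l.
  rewrite mxE; under eq_bigr do rewrite [(_^T) _ _]mxE [conn _ _ _ _]mxE mulr_sumr.
  rewrite exchange_big; apply: eq_bigr => k _; rewrite mulr_sumr.
  by apply: eq_bigr => l _; rewrite mulrC -mulrA.
rewrite -!sumrB; apply: eq_bigr => k _; rewrite [in RHS]mxE -!mulrBr; congr (_ * _).
rewrite /cov_coord big_ord_recl big_ord1 opprD addrA dmxE.
have -> : lift ord0 ord0 = ord_max :> 'I_2 by exact: val_inj.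
congr (_ - _ - _); apply: eq_bigr => l _; congr (_ * _).
  by rewrite /cov_form dfwithin dfwithout.
by rewrite /cov_form dfwithin dfwithout.
Qed.

End LocalGeometry.

(** * Change of charts and globalisation *)

Section SkewAlgebra.
Variables (R : realType) (n : nat).
Implicit Types (x : 'rV[R]_n) (U J : 'M[R]_n).

(** Indices are pulled back one at a time, [V] being [U] with only its first index transformed; each
    step is a linear combination of instances of the previous one. The same scheme proves
    [pullback_square]. *)
Lemma pullback_wedge x U J :
  (forall i j k, x 0 i * U j k - x 0 j * U i k + x 0 k * U i j = 0) ->
  let x' := x *m J^T in let U' := J *m U *m J^T in
  forall i j k, x' 0 i * U' j k - x' 0 j * U' i k + x' 0 k * U' i j = 0.
Proof.
move=> H x' U'; pose V := J *m U.
have xE i : x' 0 i = \sum_m J i m * x 0 m.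
  by rewrite mxE; apply: eq_bigr => m _; rewrite mxE mulrC.
have VE i k : V i k = \sum_m J i m * U m k by rewrite mxE.
have UE i j : U' i j = \sum_m J j m * V i m.
  by rewrite mxE; apply: eq_bigr => m _; rewrite [(_^T) _ _]mxE mulrC.
have H1 i j k : x' 0 i * U j k - x 0 j * V i k + x 0 k * V i j = 0.
  rewrite xE !VE [X in X - _]mulrC -sum_lin3.
  by rewrite big1 // => m _; rewrite [U j k * _]mulrC H mulr0.
have H2 i j k : x' 0 i * V j k - x' 0 j * V i k + x 0 k * U' i j = 0.
  rewrite [x' 0 j]xE VE UE [X in _ - X]mulrC -sum_lin3.
  by rewrite big1 // => m _; rewrite [V i k * _]mulrC H1 mulr0.
move=> i j k; rewrite [x' 0 k]xE !UE [X in _ + X]mulrC -sum_lin3 -UE.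
by rewrite big1 // => m _; rewrite [U' i j * _]mulrC H2 mulr0.
Qed.

Lemma pullback_square U J :
  (forall i j k l, U i j * U k l - U i k * U j l + U i l * U j k = 0) ->
  let U' := J *m U *m J^T in
  forall i j k l, U' i j * U' k l - U' i k * U' j l + U' i l * U' j k = 0.
Proof.
move=> H U'; pose V := J *m U.
have VE i k : V i k = \sum_m J i m * U m k by rewrite mxE.
have UE i j : U' i j = \sum_m J j m * V i m.
  by rewrite mxE; apply: eq_bigr => m _; rewrite [(_^T) _ _]mxE mulrC.
have H1 i j k l : U k l * V i j - U j l * V i k + U j k * V i l = 0.
  rewrite !VE -sum_lin3 big1 // => m _.
  by rewrite ![U _ _ * U m _]mulrC H mulr0.
have H2 i j k l : U k l * U' i j - V i k * V j l + V i l * V j k = 0.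
  rewrite UE (VE j l) (VE j k) -sum_lin3 big1 // => m _.
  by rewrite [V i k * _]mulrC [V i l * _]mulrC H1 mulr0.
have H3 i j k l : U' i j * V k l - V j l * U' i k + V i l * U' j k = 0.
  rewrite (UE i k) (UE j k) (VE k l) -sum_lin3 big1 // => m _.
  by rewrite [_ * U m l]mulrC [V j l * _]mulrC H2 mulr0.
move=> i j k l; rewrite (UE k l) (UE j l) (UE i l) [X in _ + X]mulrC.
rewrite -sum_lin3 big1 // => m _.
by rewrite [U' i k * _]mulrC [U' j k * _]mulrC H3 mulr0.
Qed.

(** The hypothesis is the Plucker relation. If [U a b] is not zero, it writes every entry through
    the entries of the rows [a] and [b], which factors [U] through a space of dimension 2. *)
Lemma rank_square_le2 U :
  (forall i j k l, U i j * U k l - U i k * U j l + U i l * U j k = 0) ->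
  (\rank U <= 2)%N.
Proof.
move=> H; have [->|/eqP U0] := eqVneq U 0; first by rewrite mxrank0.
have [a [b Uab]] : exists a b, U a b != 0.
  apply: contrapT => N; apply: U0; apply/matrixP => a b; rewrite mxE.
  by apply: contrapT => /eqP Uab; apply: N; exists a, b.
pose A : 'M[R]_(n, 1 + 1) := row_mx (\col_c (U a c / U a b)) (\col_c (U b c / U a b)).
pose B : 'M[R]_(1 + 1, n) := col_mx (\row_d U b d) (\row_d (- U a d)).
have -> : U = A *m B.
  apply/matrixP => c d; rewrite mul_row_col addmx_entry !mxE !big_ord1 !mxE.
  have E : U a b * U c d = U a c * U b d - U a d * U b c by have := H a b c d; lra.
  by apply: (mulfI Uab); rewrite E; field.
exact: leq_trans (mxrankM_maxl _ _) (rank_leq_col _).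
Qed.

(** In a rank-one matrix [A k 0 * B 0 l] a zero diagonal entry kills its row or its column, hence
    both by skewness; and the whole diagonal is zero. *)
Lemma skew_rank_gt1 U : U^T = - U -> U != 0 -> (1 < \rank U)%N.
Proof.
move=> sU U0; rewrite ltnNge; apply/negP => r1; move/negP: U0; apply; apply/eqP.
have sk i j : U j i = - U i j by have := congr1 (fun M : 'M[R]_n => M i j) sU; rewrite !mxE.
have E := mulmx_base U; move: r1 (col_base U) (row_base U) E.
case: (\rank U) => [|[|//]] _ A B E; apply/matrixP => i j; rewrite [RHS]mxE.
  by rewrite -E mxE big_ord0.
have UE k l : U k l = A k 0 * B 0 l by rewrite -E mxE big_ord1.
have /eqP : U i i = 0 by have := sk i i; lra.
rewrite UE mulf_eq0 => /orP[] /eqP Z; first by rewrite UE Z mul0r.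
by have := sk j i; rewrite [U j i]UE Z mulr0 oppr0.
Qed.

End SkewAlgebra.

(** * From charts to the connected manifold *)

Section Global.
Variables (R : realType) (n : nat) (M : smooth_manifold R n).
Variables (g : riemannian_metric M) (xi : vector_field M).
Hypothesis n_gt3 : (3 < n)%N.
Hypothesis M_connected : connected [set: M].
Hypothesis xi_killing : killing g xi.
Hypothesis xi_neq0 : exists x : M, nonzero_locus xi x.
Variable f : M -> R.
Hypothesis f_def : forall x : M, nonzero_locus xi x ->
  nabla_eq_wedge g xi (nabla_form g xi) (f x) x.
Implicit Types (a b : chart_index M) (y z : M) (p q X Y : 'rV[R]_n).

Local Notation img a := (chart_img (chart_of a)).
Local Notation dom a := (chart_dom (chart_of a)).
Local Notation map a := (chart_map (chart_of a)).
Local Notation inv a := (chart_inv (chart_of a)).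
Local Notation change a b := (transition (chart_of a) (chart_of b)).
Local Notation overlap_of a b := (overlap (chart_of a) (chart_of b)).
Local Notation U a := (killing_form (g a) (xi a)).
Local Notation x a := (killing_flat (g a) (xi a)).
Local Notation M0 := (nonzero_locus xi).

Let img_open a : open (img a). Proof. exact: chart_img_open. Qed.
Let g_smooth a : smooth_on (img a) (g a). Proof. exact: gram_smooth. Qed.
Let g_sym a q : img a q -> (g a q)^T = g a q. Proof. exact: gram_sym. Qed.
Let g_pos a q : img a q -> forall X, X != 0 -> 0 < bil (g a q) X X.
Proof. by move=> aq X X0; exact: gram_pos. Qed.
Let xi_smooth a : smooth_on (img a) (xi a). Proof. exact: vf_smooth. Qed.
Let xi_kill a q : img a q -> lie_metric (g a) (xi a) q = 0.
Proof.
move=> aq; have := @xi_killing (inv a q) a (chart_invP aq).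
by rewrite chart_invK.
Qed.

Lemma overlap_open a b : open (overlap_of a b).
Proof.
rewrite openE => q [aq bq]; apply: filterI.
  by apply: open_nbhs_nbhs; split => //; exact: chart_img_open.
apply: (chart_inv_cont aq); apply: open_nbhs_nbhs; split => //.
exact: chart_dom_open.
Qed.

Lemma overlap_map a b y : dom a y -> dom b y -> overlap_of a b (map a y).
Proof.
by move=> ay by_; split; [exact: chart_mapP|rewrite /preimage /= chart_mapK].
Qed.

Lemma change_map a b y : dom a y -> change a b (map a y) = map b y.
Proof. by move=> ay; rewrite /transition /= chart_mapK. Qed.

Lemma change_img a b q : overlap_of a b q -> img b (change a b q).
Proof. by case=> _ bq; exact: chart_mapP. Qed.

Lemma field_neq0 a b y : dom a y -> dom b y -> xi a (map a y) != 0 -> xi b (map b y) != 0.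
Proof.
move=> ay by_; apply: contraNneq => xb.
have := vf_change xi (overlap_map by_ ay); rewrite change_map // => ->.
by rewrite xb linear0.
Qed.

Lemma nonzero_locusP a y : dom a y -> (M0 y <-> xi a (map a y) != 0).
Proof.
move=> ay; split=> [|xa b by_]; first exact.
exact: (field_neq0 ay by_ xa).
Qed.

Definition jac a b q : 'M[R]_n := \matrix_(i, k) ('d (change a b) q (basis_vec R i) : 'rV[R]_n) 0 k.

Lemma jac_row a b q X : X *m jac a b q = 'd (change a b) q X.
Proof.
rewrite [X in RHS](row_sum_delta X) linear_sum; apply/rowP => k.
rewrite mxE summxE; apply: eq_bigr => i _.
by rewrite linearZ !mxE.
Qed.

Lemma flat_change a b q : overlap_of a b q ->
  x a q = x b (change a b q) *m (jac a b q)^T.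
Proof.
move=> abq; apply/rowP => i.
have := gram_change g abq (xi a q) (basis_vec R i).
rewrite -(vf_change xi abq) -jac_row trmx_mul mulmxA.
rewrite -/(x a q) -/(x b (change a b q)).
by rewrite trmx_delta -!colE !mxE.
Qed.

(* 2 u is the exterior derivative of the 1-form [x]. *)
Lemma form_change a b q : overlap_of a b q ->
  U a q = jac a b q *m U b (change a b q) *m (jac a b q)^T.
Proof.
move=> abq; have oO := @overlap_open a b.
have sphi : smooth_mx (overlap_of a b) (change a b).
  by apply: smooth_on_smooth_mx => //; exact: chart_compat.
have dphi w : overlap_of a b w -> differentiable (change a b) w.
  exact: smooth_on_diff (chart_compat a b).
have jacE i k w : overlap_of a b w ->
    jac a b w i k = 'D_(basis_vec R i) (fun v => change a b v 0 k) w.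
  move=> abw; rewrite mxE -deriveE; last exact: dphi.
  rewrite derive_mx ?mxE //; exact/diff_derivable/dphi.
have bq := change_img abq.
have sxb k : smooth_on (img b) (fun w => x b w 0 k) by exact: smooth_flat.
have sub_ab w : overlap_of a b w -> img a w by case.
pose dx m k := 'D_(basis_vec R m) (fun w => x b w 0 k) (change a b q).
have chain i k : 'D_(basis_vec R i) (fun w => x b (change a b w) 0 k) q =
    \sum_m jac a b q i m * dx m k.
  have dxb := smooth_on_diff (sxb k) bq.
  rewrite deriveE; last exact: (differentiable_comp (dphi _ abq) dxb).
  rewrite (diff_comp (dphi _ abq) dxb) /= -deriveE // derive_dir //.
  by apply: eq_bigr => m _; rewrite [jac _ _ _ _ _]mxE.
pose phi k w := change a b w 0 k.
have sphik k : smooth_on (overlap_of a b) (phi k) by exact: sphi.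
pose P j k := 'D_(basis_vec R j) (phi k).
have sP j k : smooth_on (overlap_of a b) (P j k) by exact: smooth_on_dir.
have xaE j : \forall w \near q, x a w 0 j = (\sum_k (fun w => x b (change a b w) 0 k) * P j k) w.
  apply: near_open abq _ => // w abw; rewrite (flat_change abw) mxE fct_sumE.
  by apply: eq_bigr => k _; rewrite [(_^T) _ _]mxE jacE.
have dxphi k X : derivable (fun w => x b (change a b w) 0 k) q X.
  apply: diff_derivable.
  exact: (differentiable_comp (dphi _ abq) (smooth_on_diff (sxb k) bq)).
have dP j k X : derivable (P j k) q X.
  exact/diff_derivable/(smooth_on_diff (sP j k) abq).
have Dxa i j : 'D_(basis_vec R i) (fun w => x a w 0 j) q =
    \sum_k (x b (change a b q) 0 k * 'D_(basis_vec R i) (P j k) q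
      + P j k q * \sum_m jac a b q i m * dx m k).
  rewrite (near_eq_derive _ (xaE j)) derive_sum => [|k]; last exact: derivableM.
  by apply: eq_bigr => k _; rewrite deriveM // chain.
have two0 : (2 : R) != 0 by [].
apply/matrixP => i j; apply: (mulfI two0).
rewrite -(form_curl (@img_open a) (@g_smooth a) (@g_sym a) (@g_pos a) (@xi_smooth a) (@xi_kill a) i j (sub_ab _ abq)).
rewrite !Dxa -sumrB.
transitivity (\sum_k \sum_m jac a b q i m * jac a b q j k * (dx m k - dx k m)).
  rewrite (eq_bigr (fun k => \sum_m jac a b q i m * jac a b q j k * dx m k
     - \sum_m jac a b q j m * jac a b q i k * dx m k)); last first.
    move=> k _.
    (* The second derivatives of the change of coordinates are symmetric, so they drop out of the
       curl. *)
    have sch : 'D_(basis_vec R i) (P j k) q = 'D_(basis_vec R j) (P i k) q.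
      exact: schwarz oO abq (sphik k).
    have PJ l : P l k q = jac a b q l k by rewrite jacE.
    rewrite sch !PJ.
    rewrite opprD addrACA subrr add0r !mulr_sumr; congr (_ - _);
      by apply: eq_bigr => m _; ring.
  rewrite sumrB [X in _ - X]exchange_big -sumrB; apply: eq_bigr => k _.
  by rewrite -sumrB; apply: eq_bigr => m _; ring.
rewrite -[in RHS](mulmxA (jac a b q)) mxE mulr_sumr exchange_big.
apply: eq_bigr => m _; rewrite [X in _ = _ * (_ * X)]mxE !mulr_sumr.
apply: eq_bigr => k _.
have := form_curl (@img_open b) (@g_smooth b) (@g_sym b) (@g_pos b) (@xi_smooth b) (@xi_kill b) m k bq.
rewrite -/(dx m k) -/(dx k m) => ->; rewrite [(_^T) _ _]mxE; ring.
Qed.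

Lemma form_eq0_change a b y : dom a y -> dom b y ->
  U b (map b y) = 0 -> U a (map a y) = 0.
Proof.
move=> ay by_ Ub; have := form_change (overlap_map ay by_).
by rewrite change_map // Ub mulmx0 mul0mx.
Qed.

(** The two conditions are kept together because only the pair satisfies a linear system. *)
Definition wedge_flat_zero a q :=
  (forall i j k, flat_wedge_form (g a) (xi a) i j k q = 0) /\
  (forall i j k l, form_square (g a) (xi a) i j k l q = 0).

Lemma wedge_flat_zero_change a b y : dom a y -> dom b y ->
  wedge_flat_zero b (map b y) -> wedge_flat_zero a (map a y).
Proof.
move=> ay by_ [om0 nu0]; have ab := overlap_map ay by_.
rewrite /wedge_flat_zero /flat_wedge_form /form_square (flat_change ab) (form_change ab).
by rewrite !change_map //; split; [exact: pullback_wedge|exact: pullback_square].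
Qed.

Let D a : set 'rV[R]_n := [set q | img a q /\ xi a q != 0].
Let F a q : R := f (inv a q).

Let D_open a : open (D a).
Proof.
rewrite openE => q [aq xq]; apply: filterI.
  by apply: open_nbhs_nbhs; split => //; exact: chart_img_open.
exact: (cvgr_neq0 _ (smooth_on_cont (@xi_smooth a) aq) xq).
Qed.

Let D_img a : D a `<=` img a. Proof. by move=> q []. Qed.
Let D_neq0 a q : D a q -> xi a q != 0. Proof. by case. Qed.

Lemma chart_near a y (P : 'rV[R]_n -> Prop) : dom a y ->
  (\forall q \near map a y, P q) -> \forall z \near y, dom a z /\ P (map a z).
Proof.
move=> ay HP; apply: filterI.
  by apply: open_nbhs_nbhs; split => //; exact: chart_dom_open.
exact: (chart_map_cont ay HP).
Qed.

Lemma chart_inv_near a y (P : M -> Prop) : dom a y ->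
  (\forall z \near y, P z) -> \forall q \near map a y, img a q /\ P (inv a q).
Proof.
move=> ay HP; have aq := chart_mapP ay; apply: filterI.
  by apply: open_nbhs_nbhs; split => //; exact: chart_img_open.
by apply: (chart_inv_cont aq); rewrite chart_mapK.
Qed.

Lemma nonzero_locus_chart a q : img a q -> (M0 (inv a q) <-> D a q).
Proof.
move=> aq; rewrite (nonzero_locusP (chart_invP aq)) chart_invK //.
by split=> [|[]].
Qed.

(** Being all or nothing on a neighbourhood of each point makes [S] both open and closed. *)
Lemma propagates (S : set M) :
  (forall y, exists2 V, nbhs y V & forall z w, V z -> V w -> S z -> S w) ->
  (exists y, S y) -> forall y, S y.
Proof.
move=> H [y0 Sy0] y; suff -> : S = setT by [].
apply: M_connected; first by exists y0.
- exists S; last by rewrite setTI.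
  rewrite openE => z Sz; have [V nV HV] := H z.
  by apply: filterS (nV) => w Vw; exact: HV (nbhs_singleton nV) Vw Sz.
- exists S; last by rewrite setTI.
  move=> z Sz; have [V nV HV] := H z.
  have [w [Sw Vw]] := Sz V nV.
  exact: HV Vw (nbhs_singleton nV) Sw.
Qed.

Lemma chart_ball a y r : dom a y -> 0 < r ->
  let V := [set z | dom a z /\ ball (map a y) r (map a z)] in
  nbhs y V /\ forall z, V z -> nbhs z V.
Proof.
move=> ay r0 V.
have H z : V z -> nbhs z V.
  move=> [az Bz]; apply: chart_near => //.
  by apply: open_nbhs_nbhs; split => //; exact: ball_open.
by split=> //; apply: H; split=> //; exact: ballxx.
Qed.

(** What propagates is the interior [S] of the zero set of xi: at an interior point the derivatives
    of xi vanish as well, so both xi and u are zero there. *)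
Lemma nonzero_locus_dense y : closure M0 y.
Proof.
have [y0 My0] := xi_neq0.
apply: contrapT => /existsNP[B /not_implyP[nB BM]].
pose S := [set z : M | \forall w \near z, ~ M0 w].
have Sy : S y by apply: filterS nB => w Bw Mw; apply: BM; exists w.
suff /nbhs_singleton : S y0 by [].
apply: (propagates _ (ex_intro _ y Sy)) => z.
have [a az] := chart_cover z.
have [r r0 [rO H]] := killing_zero_propagates (@img_open a) (@g_smooth a)
  (@g_sym a) (@g_pos a) (@xi_smooth a) (@xi_kill a) (chart_mapP az).
have [nV oV] := chart_ball az r0.
set V := [set _ | _] in nV oV; exists V => // v w Vv Vw Sv.
suff xi0 u : V u -> xi a (map a u) = 0.
  apply: filterS (oV w Vw) => u Vu /(nonzero_locusP (proj1 Vu)).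
  by rewrite xi0 // eqxx.
move=> [au Bu]; have [av Bv] := Vv.
have nxi : \forall q \near map a v, xi a q = 0.
  apply: filterS (chart_inv_near av Sv) => q [aq nM].
  by apply: contrapT => /eqP xq; apply/nM/(nonzero_locus_chart aq).
apply: (H _ _ Bv Bu); first exact: nbhs_singleton nxi.
have av' := chart_mapP av.
rewrite /killing_form (_ : cov_vec _ _ _ = 0) ?mul0mx //.
apply/matrixP => i k; rewrite !mxE (nbhs_singleton nxi).
rewrite big1 ?addr0 => [|j _]; last by rewrite mxE mulr0.
rewrite (partial_coord _ (@xi_smooth a) av') dmxE -(derive_cst (0 : R) (map a v) (basis_vec R i)).
by apply: near_eq_derive; apply: filterS nxi => q ->; rewrite mxE.
Qed.

Let D_dense a : img a `<=` closure (D a).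
Proof.
move=> q aq B nB.
have ay := chart_invP aq.
have nB' : \forall q \near map a (inv a q), B q by rewrite chart_invK.
have [z [Mz [az Bz]]] := nonzero_locus_dense (chart_near ay nB').
exists (map a z); split=> //; apply/nonzero_locus_chart; first exact: chart_mapP.
by rewrite chart_mapK.
Qed.

Let Dform a q X : D a q ->
  Dmx (g a) X (U a) q = F a q *: gram_wedge (g a) X (x a q) q.
Proof.
move=> Dq; have aq := D_img Dq.
have := f_def ((nonzero_locus_chart aq).2 Dq) (chart_invP aq).
rewrite chart_invK // => H; apply/matrixP => i j.
have := H X (fun k : 'I_2 => if k == ord0 then i else j).
rewrite (cov_deriv_form (@img_open a) (@g_smooth a) (@g_pos a) (@xi_smooth a)) //=.
move=> ->; rewrite scalemx_entry; congr (_ * _).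
rewrite /wedge1 big_ord_recl big_ord1 /= /form1 /gram_wedge addmx_entry oppmx_entry.
rewrite !mxE !big_ord1 ![(_^T) _ _]mxE /flat /=.
rewrite expr0 mul1r expr1 mulN1r mulNr.
by rewrite /killing_flat !mxE; congr (_ - _); rewrite mulrC.
Qed.

Lemma constant_factor : (forall a q X, D a q -> 'D_X (F a) q = 0) ->
  exists c : R, forall y, M0 y -> f y = c.
Proof.
move=> dF; have [y0 My0] := xi_neq0; exists (f y0).
(* Stated on a neighbourhood, the condition makes sense also at the zeros of xi; density of [M0]
   then provides a nearby point from which to propagate. *)
pose S := [set z : M | \forall w \near z, M0 w -> f w = f y0].
have key y : exists2 V, nbhs y V & (forall z, V z -> nbhs z V) /\
    forall z w, V z -> V w -> M0 z -> M0 w -> f z = f y0 -> f w = f y0.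
  have [a ay] := chart_cover y.
  have [r r0 [rO H]] := constant_factor_propagates (@img_open a) (@g_smooth a)
    (@g_sym a) (@g_pos a) (@xi_smooth a) (@xi_kill a) (@D_open a) (@D_img a)
    (@D_dense a) (@D_neq0 a) (@Dform a) n_gt3 (f y0) (chart_mapP ay) (dF a).
  have [nV oV] := chart_ball ay r0.
  set V := [set _ | _] in nV oV; exists V => //; split=> // z w [az Bz] [aw Bw] Mz Mw fz.
  have DM u : dom a u -> M0 u -> D a (map a u).
    by move=> au Mu; apply/nonzero_locus_chart; rewrite ?chart_mapK //; exact: chart_mapP.
  have := H _ _ Bz Bw (DM z az Mz) (DM w aw Mw).
  by rewrite /F !chart_mapK //; apply.
suff HS y : S y by move=> y My; exact: (nbhs_singleton (HS y)).
apply: propagates => [z|].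
  have [V nV [oV HV]] := key z; exists V => // v w Vv Vw Sv.
  have [v' [Mv' [Sv' Vv']]] := nonzero_locus_dense (filterI Sv (oV v Vv)).
  by apply: filterS (oV w Vw) => u Vu Mu; exact: HV Vv' Vu Mv' Mu (Sv' Mv').
have [V nV [_ HV]] := key y0; exists y0.
by apply: filterS (nV) => w Vw Mw; exact: HV (nbhs_singleton nV) Vw My0 Mw erefl.
Qed.

Lemma wedge_flat_zero_everywhere a q : D a q -> wedge_flat_zero a q ->
  forall y b, dom b y -> wedge_flat_zero b (map b y).
Proof.
move=> Dq Zq.
pose S := [set z : M | forall b, dom b z -> wedge_flat_zero b (map b z)].
apply: (propagates (S := S)) => [z|].
  have [b bz] := chart_cover z.
  have [r r0 [rO H]] := flat_wedge_propagates (@img_open b) (@g_smooth b)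
    (@g_sym b) (@g_pos b) (@xi_smooth b) (@xi_kill b) (@D_img b)
    (@D_dense b) (@D_neq0 b) (@Dform b) n_gt3 (chart_mapP bz).
  have [nV oV] := chart_ball bz r0.
  set V := [set _ | _] in nV oV; exists V => // v w [bv Bv] [bw Bw] Sv c cw.
  apply: (wedge_flat_zero_change cw bw).
  by have [om0 nu0] := Sv b bv; exact: H Bv Bw om0 nu0.
have aq := D_img Dq; exists (inv a q) => b bq.
by apply: (wedge_flat_zero_change bq (chart_invP aq)); rewrite chart_invK.
Qed.

(** Otherwise the interior [S] of the zero set of u is not empty. By density it contains a point of
    [M0], where [F] vanishes too by [factor_eq0]; then u would vanish everywhere, contradicting
    [Uq]. *)
Lemma form_nonzero_dense a q : img a q -> U a q != 0 ->
  forall y, closure [set z | forall b, dom b z -> U b (map b z) != 0] y.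
Proof.
move=> aq Uq y; apply: contrapT => /existsNP[B /not_implyP[nB BM]].
pose S := [set z : M | \forall w \near z, forall b, dom b w -> U b (map b w) = 0].
have Sy : S y.
  apply: filterS nB => w Bw b bw; apply: contrapT => /eqP Ub; apply: BM.
  exists w; split=> // c cw; apply: contraNneq Ub => Uc; apply/eqP.
  exact: form_eq0_change bw cw Uc.
have SE z : S z -> forall b, dom b z -> U b (map b z) = 0.
  by move=> Sz; exact: (nbhs_singleton Sz).
have nSq : ~ S (inv a q).
  by move=> /SE/(_ a (chart_invP aq)); rewrite chart_invK // => Z; rewrite Z eqxx in Uq.
apply: nSq; apply: (propagates _ (ex_intro _ y Sy)) => z.
have [b bz] := chart_cover z.
have [r r0 [rO H]] := zero_form_propagates (@img_open b) (@g_smooth b)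
  (@g_sym b) (@g_pos b) (@xi_smooth b) (@D_open b) (@D_img b)
  (@D_dense b) (@Dform b) n_gt3 (chart_mapP bz).
have [nV oV] := chart_ball bz r0.
set V := [set _ | _] in nV oV; exists V => // v w Vv Vw Sv.
have Sv' : \forall u \near v, S u by exact: (nbhs_interior Sv).
have [v' [Mv' [{}Sv' Vv']]] := nonzero_locus_dense (filterI Sv' (oV v Vv)).
have [bv' Bv'] := Vv'.
have Dv' : D b (map b v').
  by apply/nonzero_locus_chart; rewrite ?chart_mapK //; exact: chart_mapP.
have nU : \forall p \near map b v', U b p = 0.
  apply: filterS (chart_inv_near bv' Sv') => p [bp Up].
  by have := Up b (chart_invP bp); rewrite chart_invK.
have F0 : F b (map b v') = 0.
  exact: (factor_eq0 (@g_sym b) (@g_pos b) (@D_img b) (@D_neq0 b) (@Dform b) n_gt3 Dv' nU).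
apply: filterS (oV w Vw) => u [bu Bu] c cu; apply: (form_eq0_change cu bu).
exact: H Bv' Bu Dv' (nbhs_singleton nU) F0.
Qed.

Let rank_cov a q : img a q -> \rank (cov_vec (g a) (xi a) q) = \rank (U a q).
Proof.
move=> aq; rewrite /killing_form mxrankMfree //.
by rewrite row_free_unit (gram_unit (@g_pos a)).
Qed.

Lemma nonconstant_factor a q X : D a q -> 'D_X (F a) q != 0 ->
  nabla_has_rank g xi 2 /\ wedge_vanishes g xi (nabla_form g xi).
Proof.
move=> Dq dF; have aq := D_img Dq.
have [Uq [e [c UE]]] := form_rank_two (@img_open a) (@g_smooth a)
  (@g_sym a) (@g_pos a) (@xi_smooth a) (@xi_kill a) (@D_open a) (@D_img a)
  (@D_neq0 a) (@Dform a) n_gt3 Dq (ex_intro _ X dF).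
have Zq : wedge_flat_zero a q.
  rewrite /wedge_flat_zero /flat_wedge_form /form_square.
  by split=> [i j k|i j k l]; rewrite !UE; ring.
have Z := wedge_flat_zero_everywhere Dq Zq.
have le2 b y : dom b y -> (\rank (U b (map b y)) <= 2)%N.
  by move=> by_; apply: rank_square_le2; have [] := Z y b by_.
split; last first.
  move=> y b by_ I; have [om0 _] := Z y b by_.
  pose i1 : 'I_3 := lift ord0 ord0; pose i2 : 'I_3 := lift ord0 (lift ord0 ord0).
  have e1 : lift i1 ord0 = ord0 by exact: val_inj.
  have e2 : lift i2 ord0 = ord0 by exact: val_inj.
  have e3 : lift ord0 ord_max = i2 by exact: val_inj.
  have e4 : lift i1 ord_max = i2 by exact: val_inj.
  have e5 : lift i2 ord_max = i1 by exact: val_inj.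
  rewrite -(om0 (I ord0) (I i1) (I i2)) /wedge1 !big_ord_recl big_ord0 addr0.
  rewrite /nabla_form /cov_form /= -/i1 -/i2 e1 e2 e3 e4 e5 /flat_wedge_form.
  by rewrite -/(U b _) -/(x b _) -/i1 -/i2; ring.
split=> [W [y Wy] oW|y b by_]; last first.
  by rewrite rank_cov ?le2 //; exact: chart_mapP.
have [z [Uz Wz]] := form_nonzero_dense aq Uq (open_nbhs_nbhs (conj oW Wy)).
exists z; split=> // b bz; have bp := chart_mapP bz.
rewrite rank_cov //; apply/eqP; rewrite eqn_leq le2 //.
apply: skew_rank_gt1; last exact: Uz.
exact: (form_skew (@img_open b) (@g_smooth b) (@g_sym b) (@g_pos b) (@xi_smooth b) (@xi_kill b) bp).
Qed.

End Global.

Theorem proposition4p1 (R : realType) (n : nat) (n_gt3 : (3 < n)%N)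
    (M : smooth_manifold R n) (M_connected : connected [set: M])
    (g : riemannian_metric M) (xi : vector_field M)
    (xi_killing : killing g xi)
    (xi_neq0 : exists x : M, nonzero_locus xi x)
    (u_twistor : twistor_form g (nabla_form g xi))
    (f : M -> R)
    (f_def : forall x : M, nonzero_locus xi x ->
               nabla_eq_wedge g xi (nabla_form g xi) (f x) x) :
  (exists c : R, forall x : M, nonzero_locus xi x -> f x = c) \/
  (nabla_has_rank g xi 2 /\ wedge_vanishes g xi (nabla_form g xi)).
Proof.
(* ['D_X] is defined for every function; by [smooth_factor] it is a genuine derivative here, so the
   split is whether df is nonzero somewhere on M_0. *)
have [[a [q [X [Dq dF]]]]|N] := pselect (exists a q X,
    (chart_img (chart_of a) q /\ xi a q != 0) /\
    'D_X (fun p => f (chart_inv (chart_of a) p)) q != 0).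
  right; exact: (nonconstant_factor n_gt3 M_connected xi_killing xi_neq0 f_def Dq dF).
left; apply: (constant_factor n_gt3 M_connected xi_killing xi_neq0 f_def) => a q X Dq.
by apply: contrapT => /eqP dF; apply: N; exists a, q, X.
Qed.
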